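(* There is a polynomial time algorithm (polynomial in the size of the input matrix) which, given a voting form $g\in A^{k\times\ell}$ whose corresponding parameters satisfy $p\ge 3$, $\alpha\le 2$ and $\beta\le 2$, decides whether $g$ is a DAV form.
   Context: There are two voters. A voting form is a matrix $g\in A^{k\times\ell}$, where $A$, the set of candidates, is the set of elements appearing in the matrix, and $p=|A|$. It is assumed that there are positive integers $\alpha,\beta$ (the numbers of voting cards of the first and second voter) with $k=\binom{\alpha+p-1}{p-1}$ and $\ell=\binom{\beta+p-1}{p-1}$; $p,\alpha,\beta$ are the parameters corresponding to $g$. The sets of voting strategies are $X=\{x\in\mathbb{Z}_{\ge 0}^A : \sum_{a\in A}x_a=\alpha\}$ and $Y=\{y\in\mathbb{Z}_{\ge 0}^A : \sum_{a\in A}y_a=\beta\}$, so $|X|=k$, $|Y|=\ell$. For $z\in\mathbb{Z}^A$ let $AM(z)=\{a\in A : z_a=\max_{c\in A}z_c\}$. The matrix $g$ is a distributed approval voting form (DAV form) if the strategies can be labeled bijectively as $X=\{x^1,\dots,x^k\}$, $Y=\{y^1,\dots,y^\ell\}$ such that $g(i,j)\in AM(x^i+y^j)$ for all $i=1,\dots,k$, $j=1,\dots,\ell$. *)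

(* Defs.v *)
From HB Require Import structures.
From mathcomp Require Import all_boot all_order all_algebra.

Set Implicit Arguments.
Unset Strict Implicit.
Unset Printing Implicit Defensive.

(** * Voting forms *)

Section VotingForms.
Context {T : choiceType} {k l : nat} (g : 'M[T]_(k, l)).

Definition row_major : seq T :=
  [seq g i j | i <- enum 'I_k, j <- enum 'I_l].

Definition entries : seq T := undup row_major.

Lemma mem_entries i j : g i j \in entries.
Proof. by rewrite mem_undup; apply: allpairs_f; rewrite mem_enum. Qed.

(* The set A of candidates, as a finite type: exactly the elements of T that
   appear in g. *)
Definition cand : finType := seq_sub entries.

Definition entry (i : 'I_k) (j : 'I_l) : cand := SeqSub (mem_entries i j).

Definition ncand : nat := #|cand|.

End VotingForms.

Definition strategy (A : finType) (n : nat) : Type :=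
  {x : {ffun A -> nat} | \sum_(a : A) x a == n}.

(* AM is only ever applied to a sum of two strategies, so nonnegative integer
   vectors suffice; there \max is the true maximum. *)
Definition AM (A : finType) (z : A -> nat) : {set A} :=
  [set a | z a == \max_(c : A) z c].

Definition voting_form (T : choiceType) (k l : nat) (g : 'M[T]_(k, l))
    (alpha beta : nat) : Prop :=
  let p := ncand g in
  [/\ 0 < alpha, 0 < beta,
      k = 'C(alpha + p - 1, p - 1) & l = 'C(beta + p - 1, p - 1)].

Definition DAV_form (T : choiceType) (k l : nat) (g : 'M[T]_(k, l))
    (alpha beta : nat) : Prop :=
  exists (x : 'I_k -> strategy (cand g) alpha)
         (y : 'I_l -> strategy (cand g) beta),
    [/\ bijective x, bijective y &
        forall i j, entry g i j \in AM (fun a => val (x i) a + val (y j) a)].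

(** * Programs and running time

   Random access machines with the Cook-Reckhow operations (constants, addition,
   truncated subtraction, indirect reads and writes) under unit cost, with
   structured control flow.  A program mentions finitely many registers
   and arrays, and all of them hold natural numbers.  There is no unit-cost
   multiplication or shift: in t steps the bit length of the stored numbers
   grows by O(t), so for deciding problems in polynomial time the model is
   equivalent to Turing machines. *)

Inductive expr : Type :=
| Const of nat
| Reg of nat
| Read of nat & expr            (* Read a e is the cell e of the array a *)
| Add of expr & expr
| Sub of expr & expr.

Inductive cmd : Type :=
| Skip
| Assign of nat & expr           (* register := value *)
| Write of nat & expr & expr     (* Write a e1 e2 is a[e1] := e2 *)
| Seq of cmd & cmd
| If of expr & cmd & cmd         (* a test succeeds when it is nonzero *)
| While of expr & cmd.

Record state : Type := State { regs : nat -> nat; arrs : nat -> nat -> nat }.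

Definition upd (V : Type) (f : nat -> V) (x : nat) (v : V) : nat -> V :=
  fun y => if y == x then v else f y.

Definition set_reg (s : state) (x v : nat) : state :=
  State (upd (regs s) x v) (arrs s).

Definition set_cell (s : state) (a i v : nat) : state :=
  State (regs s) (upd (arrs s) a (upd (arrs s a) i v)).

Fixpoint eval (s : state) (e : expr) : nat :=
  match e with
  | Const n => n
  | Reg x => regs s x
  | Read a e1 => arrs s a (eval s e1)
  | Add e1 e2 => eval s e1 + eval s e2
  | Sub e1 e2 => eval s e1 - eval s e2
  end.

Fixpoint cost (e : expr) : nat :=
  match e with
  | Const _ | Reg _ => 1
  | Read _ e1 => (cost e1).+1
  | Add e1 e2 | Sub e1 e2 => (cost e1 + cost e2).+1
  end.

(* exec c s t s' : started in s, the command c halts after t steps in s'.  The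
   relation is deterministic, and no t, s' exist when c diverges from s. *)
Inductive exec : cmd -> state -> nat -> state -> Prop :=
| ExecSkip s : exec Skip s 1 s
| ExecAssign s x e : exec (Assign x e) s (cost e).+1 (set_reg s x (eval s e))
| ExecWrite s a e1 e2 :
    exec (Write a e1 e2) s (cost e1 + cost e2).+1
         (set_cell s a (eval s e1) (eval s e2))
| ExecSeq c1 c2 s1 s2 s3 t1 t2 :
    exec c1 s1 t1 s2 -> exec c2 s2 t2 s3 -> exec (Seq c1 c2) s1 (t1 + t2) s3
| ExecIfTrue e c1 c2 s t s' :
    eval s e != 0 -> exec c1 s t s' -> exec (If e c1 c2) s (cost e + t).+1 s'
| ExecIfFalse e c1 c2 s t s' :
    eval s e = 0 -> exec c2 s t s' -> exec (If e c1 c2) s (cost e + t).+1 s'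
| ExecWhileStop e c s :
    eval s e = 0 -> exec (While e c) s (cost e).+1 s
| ExecWhileStep e c s1 s2 s3 t1 t2 :
    eval s1 e != 0 -> exec c s1 t1 s2 -> exec (While e c) s2 t2 s3 ->
    exec (While e c) s1 (cost e + t1 + t2).+1 s3.

(* Input convention: the dimensions k and l are in registers 0 and 1, the matrix
   is stored row by row in array 0, and everything else is 0.  In particular
   alpha, beta and p are not given to the program, and the names of the
   candidates are arbitrary natural numbers. *)
Definition input (k l : nat) (g : 'M[nat]_(k, l)) : state :=
  State (fun x => if x == 0 then k else if x == 1 then l else 0)
        (fun a n => if a == 0 then nth 0 (row_major g) n else 0).

(* The answer is read off register 0: 1 for yes, 0 for no. *)
Definition answers (s : state) (P : Prop) : Prop :=
  (regs s 0 = 1 /\ P) \/ (regs s 0 = 0 /\ ~ P).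

(* Main.v *)
Require Import Defs.
From HB Require Import structures.
From mathcomp Require Import all_boot all_order all_algebra.
From mathcomp Require Import zify.

Set Implicit Arguments.
Unset Strict Implicit.
Unset Printing Implicit Defensive.

(** Counting occurrences recovers one side of the labelling.  With weights (1, 2) the
    label of a row is the only candidate that occurs in it at least p times; with
    weights (2, 2) the candidates of the label of a row are those that occur at least
    p - 1 times; with weights (1, 1) a candidate that occurs twice in a row is its label,
    while a row without repetitions lists the labels of the columns.  The remaining
    cases are transposed.  So after guessing the orientation, the threshold and a column
    that labels the rows without frequent candidate, all row labels are known.  What is
    left is a perfect matching between labels and columns, found by an auction: an
    unassigned label buys the cheapest column it is compatible with, expelling the
    owner and raising the price by 1; if a perfect matching exists, no column sells
    above the number of columns.

    Running times are polynomial by construction: the program is written in a language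
    whose only loops and sums range over 0, ..., k l - 1, and compiled to commands. *)

(** * A loop language with bounded sums, and its compiler *)

(** A guess is never trusted. Acceptance requires that the recovered row labels form a labelling and
    that every column label owns a compatible column, and these two facts certify a DAV form. The
    counting arguments therefore serve completeness only. Once the rows are labelled, whether a
    label fits a column depends on that column alone; this is why a bipartite matching remains. Ties
    are the obstacle. With weights (1, 1) the entry in row a and column b may be a or b, so a row
    need not betray its own label by counting. With weights (2, 2) a row labelled 2 e_a may show
    every other candidate once, and p >= 3 keeps this below the threshold p - 1. The weights are not
    part of the input; they follow from the dimensions because p < p (p + 1) / 2. An auction suits
    bounded loops: its state is a few arrays, a bid is a handful of searches, and the sum of the
    prices grows by 1 with each bid, so (k l)^2 rounds suffice and no path has to be stored. *)

Definition runs (c : cmd) (s : state) (T : nat) (s' : state) : Prop :=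
  exists2 t, exec c s t s' & t <= T.

Lemma runs_le c s T T' s' : T <= T' -> runs c s T s' -> runs c s T' s'.
Proof. by move=> leT [t ex let_]; exists t => //; apply: leq_trans leT. Qed.

Lemma runs_assign s x e : runs (Assign x e) s (cost e).+1 (set_reg s x (eval s e)).
Proof. by exists (cost e).+1 => //; apply: ExecAssign. Qed.

Lemma runs_write s a e1 e2 :
  runs (Write a e1 e2) s (cost e1 + cost e2).+1 (set_cell s a (eval s e1) (eval s e2)).
Proof. by exists (cost e1 + cost e2).+1 => //; apply: ExecWrite. Qed.

Lemma runs_seq c1 c2 s T1 s1 T2 s2 :
  runs c1 s T1 s1 -> runs c2 s1 T2 s2 -> runs (Seq c1 c2) s (T1 + T2) s2.
Proof.
move=> [t1 ex1 le1] [t2 ex2 le2]; exists (t1 + t2); last exact: leq_add.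
exact: ExecSeq ex1 ex2.
Qed.

Lemma runs_if e c1 c2 s T s' :
  runs (if eval s e != 0 then c1 else c2) s T s' ->
  runs (If e c1 c2) s (cost e + T).+1 s'.
Proof.
case: ifP => [ne|/negbFE/eqP eq0] [t ex let_];
  exists (cost e + t).+1; rewrite ?ltnS ?leq_add2l //.
  exact: ExecIfTrue.
exact: ExecIfFalse.
Qed.

(** The guard evaluates to the number [n - i] of remaining rounds, so the loop stops after exactly
    [n] rounds; every loop below has this form. *)
Lemma runs_while (P : nat -> state -> Prop) e c T n s :
  (forall i s, P i s -> eval s e = n - i) ->
  (forall i s, i < n -> P i s -> exists2 s', runs c s T s' & P i.+1 s') ->
  P 0 s ->
  exists2 s', runs (While e c) s ((cost e + T).+1 * n + (cost e).+1) s' & P n s'.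
Proof.
move=> Pe Pc P0.
suff IH m i s1 : i + m = n -> P i s1 ->
    exists2 s', runs (While e c) s1 ((cost e + T).+1 * m + (cost e).+1) s' & P n s'.
  exact: IH P0.
elim: m i s1 => [|m IHm] i s1 im Pi.
  exists s1; last by rewrite -im addn0.
  exists (cost e).+1; last by rewrite muln0.
  by apply: ExecWhileStop; rewrite (Pe _ _ Pi) -im addn0 subnn.
have lt_in : i < n by lia.
have [s2 [t1 ex1 le1] P2] := Pc _ _ lt_in Pi.
have [|s3 [t2 ex2 le2] P3] := IHm i.+1 s2 _ P2; first by lia.
exists s3 => //; exists (cost e + t1 + t2).+1; last by nia.
by apply: ExecWhileStep ex1 ex2; rewrite (Pe _ _ Pi); lia.
Qed.

(* Register 2 holds the bound of all sums and loops; no program of the loop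
   language assigns it. *)
Inductive hexp : Type :=
| HC of nat
| HR of nat
| HRd of nat & hexp
| HAdd of hexp & hexp
| HSub of hexp & hexp
| HIf of hexp & hexp & hexp
| HSum of nat & hexp.

Fixpoint heval (ar : nat -> nat -> nat) (rg : nat -> nat) (e : hexp) : nat :=
  match e with
  | HC n => n
  | HR x => rg x
  | HRd a e => ar a (heval ar rg e)
  | HAdd e1 e2 => heval ar rg e1 + heval ar rg e2
  | HSub e1 e2 => heval ar rg e1 - heval ar rg e2
  | HIf e e1 e2 => if heval ar rg e != 0 then heval ar rg e1 else heval ar rg e2
  | HSum x e => \sum_(0 <= i < rg 2) heval ar (upd rg x i) e
  end.

(** [d] separates the registers of the source from the temporaries of the compiler, which start at
    [d]. *)
Fixpoint hwf (d : nat) (e : hexp) : bool :=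
  match e with
  | HC n => true
  | HR x => x < d
  | HRd a e => hwf d e
  | HAdd e1 e2 | HSub e1 e2 => hwf d e1 && hwf d e2
  | HIf e e1 e2 => [&& hwf d e, hwf d e1 & hwf d e2]
  | HSum x e => [&& x < d, x != 2 & hwf d e]
  end.

Lemma hwfW d d' e : d <= d' -> hwf d e -> hwf d' e.
Proof.
move=> led; elim: e => //= [x|e1 IH1 e2 IH2|e1 IH1 e2 IH2|e IH e1 IH1 e2 IH2|x e IH].
- by move/leq_trans; apply.
- by case/andP=> /IH1-> /IH2->.
- by case/andP=> /IH1-> /IH2->.
- by case/and3P=> /IH-> /IH1-> /IH2->.
- by case/and3P=> ltx -> /IH->; rewrite (leq_trans ltx).
Qed.

Lemma heval_ext d ar rg rg' e : 2 < d ->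
  (forall x, x < d -> rg x = rg' x) -> hwf d e -> heval ar rg e = heval ar rg' e.
Proof.
move=> d2; elim: e rg rg' => //=.
- by move=> x rg rg' eqrg ltx; apply: eqrg.
- by move=> a e IH rg rg' eqrg /(IH _ _ eqrg)->.
- by move=> e1 IH1 e2 IH2 rg rg' eqrg /andP[/(IH1 _ _ eqrg)-> /(IH2 _ _ eqrg)->].
- by move=> e1 IH1 e2 IH2 rg rg' eqrg /andP[/(IH1 _ _ eqrg)-> /(IH2 _ _ eqrg)->].
- move=> e IH e1 IH1 e2 IH2 rg rg' eqrg.
  by case/and3P=> /(IH _ _ eqrg)-> /(IH1 _ _ eqrg)-> /(IH2 _ _ eqrg)->.
move=> x e IH rg rg' eqrg /and3P[ltx nx2 wfe]; rewrite eqrg //.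
apply: eq_bigr => i _; apply: IH => // y lty.
by rewrite /upd; case: ifP => // _; apply: eqrg.
Qed.

(** The value ends up in register [d]. A sum accumulates in [d], saves its bound variable in [d.+1]
    and evaluates its body from [d.+2] on; since the variable is restored at the end, evaluation has
    no side effect below [d]. *)
Fixpoint ecompile (d : nat) (e : hexp) : cmd :=
  match e with
  | HC n => Assign d (Const n)
  | HR x => Assign d (Reg x)
  | HRd a e => Seq (ecompile d e) (Assign d (Read a (Reg d)))
  | HAdd e1 e2 =>
      Seq (ecompile d e1) (Seq (ecompile d.+1 e2) (Assign d (Add (Reg d) (Reg d.+1))))
  | HSub e1 e2 =>
      Seq (ecompile d e1) (Seq (ecompile d.+1 e2) (Assign d (Defs.Sub (Reg d) (Reg d.+1))))
  | HIf e e1 e2 => Seq (ecompile d e) (If (Reg d) (ecompile d e1) (ecompile d e2))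
  | HSum x e =>
      Seq (Assign d.+1 (Reg x)) (Seq (Assign d (Const 0)) (Seq (Assign x (Const 0))
       (Seq (While (Defs.Sub (Reg 2) (Reg x))
              (Seq (ecompile d.+2 e) (Seq (Assign d (Add (Reg d) (Reg d.+2)))
                                          (Assign x (Add (Reg x) (Const 1))))))
            (Assign x (Reg d.+1)))))
  end.

(** A conditional pays for both branches: a sum in place of a maximum keeps the bound polynomial. In
    a sum, 6 pays for the three initial assignments, and 12 for the guard and the two updates of a
    round. *)
Fixpoint etime (e : hexp) (n : nat) : nat :=
  match e with
  | HC _ | HR _ => 2
  | HRd _ e => etime e n + 3
  | HAdd e1 e2 | HSub e1 e2 => etime e1 n + (etime e2 n + 4)
  | HIf e e1 e2 => etime e n + (etime e1 n + etime e2 n + 2)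
  | HSum x e => 6 + ((12 + etime e n) * n + 4) + 2
  end.

Definition keeps (d : nat) (s s' : state) : Prop :=
  arrs s' = arrs s /\ forall x, x < d -> regs s' x = regs s x.

Lemma updE (V : Type) (f : nat -> V) x v y :
  upd f x v y = if y == x then v else f y.
Proof. by []. Qed.

Lemma upd_id (V : Type) (f : nat -> V) x v : upd f x v x = v.
Proof. by rewrite /upd eqxx. Qed.

Lemma upd_neq (V : Type) (f : nat -> V) x v y : y != x -> upd f x v y = f y.
Proof. by rewrite /upd => /negbTE->. Qed.

Lemma keeps_trans d s1 s2 s3 : keeps d s1 s2 -> keeps d s2 s3 -> keeps d s1 s3.
Proof.
by move=> [a1 r1] [a2 r2]; split=> [|x ltx]; rewrite ?a2 ?r2 ?a1 ?r1.
Qed.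

Lemma keepsW d d' s s' : d <= d' -> keeps d' s s' -> keeps d s s'.
Proof. by move=> led [a r]; split=> // x ltx; apply: r; apply: leq_trans led. Qed.

Lemma keeps_set d s x v : d <= x -> keeps d s (set_reg s x v).
Proof. by move=> lex; split=> // y lty /=; apply: upd_neq; lia. Qed.

Lemma ecompileP e d s : 2 < d -> hwf d e ->
  exists2 s', runs (ecompile d e) s (etime e (regs s 2)) s' &
    keeps d s s' /\ regs s' d = heval (arrs s) (regs s) e.
Proof.
elim: e d s => /=.
- move=> n d s d2 _; exists (set_reg s d n); first exact: (runs_assign s d (Const n)).
  by split; [apply: keeps_set | rewrite /= upd_id].
- move=> x d s d2 ltx; exists (set_reg s d (regs s x)).
    exact: (runs_assign s d (Reg x)).
  by split; [apply: keeps_set | rewrite /= upd_id].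
- move=> a e IH d s d2 wfe; have [s1 r1 [k1 v1]] := IH d s d2 wfe.
  exists (set_reg s1 d (arrs s1 a (regs s1 d))).
    exact: runs_seq r1 (runs_assign s1 d (Read a (Reg d))).
  split; last by rewrite /= upd_id v1 k1.1.
  exact: keeps_trans k1 (keeps_set _ _ _).
- move=> e1 IH1 e2 IH2 d s d2 /andP[wf1 wf2].
  have [s1 r1 [k1 v1]] := IH1 d s d2 wf1.
  have [||s2 r2 [k2 v2]] := IH2 d.+1 s1; [by lia|exact: hwfW wf2|].
  exists (set_reg s2 d (regs s2 d + regs s2 d.+1)).
    rewrite k1.2 // in r2; apply: runs_seq r1 _; apply: runs_seq r2 _.
    exact: (runs_assign s2 d (Add (Reg d) (Reg d.+1))).
  split; first by apply: keeps_trans k1 (keeps_trans (keepsW _ k2) (keeps_set _ _ _)).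
  rewrite /= upd_id v2 k2.2 // v1 k1.1; congr (_ + _).
  by apply: (heval_ext _ d2) wf2 => x ltx; apply: k1.2.
- move=> e1 IH1 e2 IH2 d s d2 /andP[wf1 wf2].
  have [s1 r1 [k1 v1]] := IH1 d s d2 wf1.
  have [||s2 r2 [k2 v2]] := IH2 d.+1 s1; [by lia|exact: hwfW wf2|].
  exists (set_reg s2 d (regs s2 d - regs s2 d.+1)).
    rewrite k1.2 // in r2; apply: runs_seq r1 _; apply: runs_seq r2 _.
    exact: (runs_assign s2 d (Defs.Sub (Reg d) (Reg d.+1))).
  split; first by apply: keeps_trans k1 (keeps_trans (keepsW _ k2) (keeps_set _ _ _)).
  rewrite /= upd_id v2 k2.2 // v1 k1.1; congr (_ - _).
  by apply: (heval_ext _ d2) wf2 => x ltx; apply: k1.2.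
- move=> e IH e1 IH1 e2 IH2 d s d2 /and3P[wf wf1 wf2].
  have [s0 r0 [k0 v0]] := IH d s d2 wf.
  have eqv e' : hwf d e' -> heval (arrs s0) (regs s0) e' = heval (arrs s) (regs s) e'.
    move=> wfe; rewrite k0.1; apply: heval_ext wfe => // x ltx; exact: k0.2.
  rewrite -v0; case: ifP => [ne|eq0].
    have [s1 r1 [k1 v1]] := IH1 d s0 d2 wf1; exists s1; last first.
      by rewrite v1 eqv //; split=> //; apply: keeps_trans k1.
    apply: runs_seq r0 _; apply: (@runs_le _ _ (1 + etime e1 (regs s0 2)).+1).
      by rewrite k0.2 //; lia.
    by apply: runs_if; rewrite /= ne.
  have [s1 r1 [k1 v1]] := IH2 d s0 d2 wf2; exists s1; last first.
    by rewrite v1 eqv //; split=> //; apply: keeps_trans k1.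
  apply: runs_seq r0 _; apply: (@runs_le _ _ (1 + etime e2 (regs s0 2)).+1).
    by rewrite k0.2 //; lia.
  by apply: runs_if; rewrite /= eq0.
move=> x e IH d s d2 /and3P[ltx nx2 wfe].
set s1 := set_reg (set_reg (set_reg s d.+1 (regs s x)) d 0) x 0.
set n := regs s 2.
(* In the last clause the upper limit is the round number; only the summand sees the index that
   shadows it. *)
pose P i s' := [/\ i <= n, arrs s' = arrs s, regs s' x = i,
  regs s' d.+1 = regs s x /\ (forall y, y < d -> y != x -> regs s' y = regs s y) &
  regs s' d = \sum_(0 <= i < i) heval (arrs s) (upd (regs s) x i) e].
have [|||s2 r2] := @runs_while P (Defs.Sub (Reg 2) (Reg x))
  (Seq (ecompile d.+2 e) (Seq (Assign d (Add (Reg d) (Reg d.+2)))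
                              (Assign x (Add (Reg x) (Const 1)))))
  (etime e n + (4 + 4)) n s1.
- move=> i s' [lei eqa eqx [_ eqr] _] /=.
  by rewrite eqx eqr // eq_sym.
- move=> i s' lti [lei eqa eqx [eqd1 eqr] eqd].
  have [||s2 r2 [k2 v2]] := IH d.+2 s'; [by lia|by apply: hwfW wfe; lia|].
  have eqr2 : regs s' 2 = n by apply: eqr => //; rewrite eq_sym.
  exists (set_reg (set_reg s2 d (regs s2 d + regs s2 d.+2)) x i.+1).
    apply: runs_seq.
      by rewrite eqr2 in r2; exact: r2.
    apply: runs_seq; first exact: (runs_assign s2 d (Add (Reg d) (Reg d.+2))).
    set s3 := set_reg s2 _ _.
    suff -> : i.+1 = eval s3 (Add (Reg x) (Const 1)) by apply: runs_assign.
    by rewrite /= upd_neq; [rewrite k2.2 ?eqx; lia | lia].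
  split=> //=.
  + by rewrite k2.1.
  + by rewrite upd_id.
  + split; first by rewrite !upd_neq ?k2.2 ?eqd1 //; lia.
    by move=> y lty nyx; rewrite !upd_neq ?k2.2 ?eqr //; lia.
  + rewrite upd_neq; last by lia.
    rewrite upd_id v2 k2.2 // eqd big_nat_recr //=; congr (_ + _).
    rewrite eqa; apply: (heval_ext _ d2) wfe => y lty.
    by rewrite updE; case: eqP => [->//|/eqP ny]; rewrite ?eqr.
- split=> //=.
  + by rewrite upd_id.
  + split; first by rewrite upd_neq; [rewrite upd_neq ?upd_id|]; lia.
    by move=> y lty nyx; rewrite !upd_neq //; lia.
  + by rewrite upd_neq ?upd_id ?big_nil ?big_geq //; lia.
move=> [_ eqa eqx [eqd1 eqr] eqd].
exists (set_reg s2 x (regs s x)).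
  apply: (@runs_le _ _ (2 + (2 + (2 + (((3 + (etime e n + (4 + 4))).+1 * n + 4) + 2))))).
    by nia.
  apply: runs_seq; first exact: (runs_assign s d.+1 (Reg x)).
  apply: runs_seq; first exact: (runs_assign _ d (Const 0)).
  apply: runs_seq; first exact: (runs_assign _ x (Const 0)).
  apply: runs_seq; first exact: r2.
  by rewrite -eqd1; apply: (runs_assign s2 x (Reg d.+1)).
split; last by rewrite /= upd_neq //; lia.
split=> //= y lty; rewrite updE; case: eqP => [->//|/eqP ny]; exact: eqr.
Qed.

(** * Commands of the loop language and their compilation *)

Inductive hcmd : Type :=
| HAsg of nat & hexp
| HWr of nat & hexp & hexp
| HSeq of hcmd & hcmd
| HCond of hexp & hcmd & hcmd
| HFor of nat & hcmd
| HSkip.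

(** A total function: [HFor] reads its number of rounds once, at entry, and resets its counter
    before each round. *)
Fixpoint hsem (c : hcmd) (s : state) : state :=
  match c with
  | HAsg x e => set_reg s x (heval (arrs s) (regs s) e)
  | HWr a e1 e2 =>
      set_cell s a (heval (arrs s) (regs s) e1) (heval (arrs s) (regs s) e2)
  | HSeq c1 c2 => hsem c2 (hsem c1 s)
  | HCond e c1 c2 =>
      if heval (arrs s) (regs s) e != 0 then hsem c1 s else hsem c2 s
  | HFor x c => iteri (regs s 2) (fun i s' => hsem c (set_reg s' x i)) s
  | HSkip => s
  end.

Fixpoint cwf (d : nat) (c : hcmd) : bool :=
  match c with
  | HAsg x e => [&& x < d, x != 2 & hwf d e]
  | HWr _ e1 e2 => hwf d e1 && hwf d e2
  | HSeq c1 c2 => cwf d c1 && cwf d c2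
  | HCond e c1 c2 => [&& hwf d e, cwf d c1 & cwf d c2]
  | HFor x c => [&& x < d, x != 2 & cwf d c]
  | HSkip => true
  end.

Fixpoint ccompile (d : nat) (c : hcmd) : cmd :=
  match c with
  | HAsg x e => Seq (ecompile d e) (Assign x (Reg d))
  | HWr a e1 e2 =>
      Seq (ecompile d e1) (Seq (ecompile d.+1 e2) (Write a (Reg d) (Reg d.+1)))
  | HSeq c1 c2 => Seq (ccompile d c1) (ccompile d c2)
  | HCond e c1 c2 => Seq (ecompile d e) (If (Reg d) (ccompile d c1) (ccompile d c2))
  | HFor x c =>
      Seq (Assign d (Const 0))
        (While (Defs.Sub (Reg 2) (Reg d))
           (Seq (Assign x (Reg d))
              (Seq (ccompile d.+1 c) (Assign d (Add (Reg d) (Const 1))))))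
  | HSkip => Skip
  end.

Fixpoint ctime (c : hcmd) (n : nat) : nat :=
  match c with
  | HAsg _ e => etime e n + 2
  | HWr _ e1 e2 => etime e1 n + (etime e2 n + 3)
  | HSeq c1 c2 => ctime c1 n + ctime c2 n
  | HCond e c1 c2 => etime e n + (ctime c1 n + ctime c2 n + 2)
  | HFor _ c => 2 + ((10 + ctime c n) * n + 4)
  | HSkip => 1
  end.

Lemma cwf_hsem2 D c s : cwf D c -> regs (hsem c s) 2 = regs s 2.
Proof.
elim: c s => //=.
- by move=> x e s /and3P[_ nx _]; rewrite upd_neq // eq_sym.
- by move=> c1 IH1 c2 IH2 s /andP[w1 w2]; rewrite IH2 ?IH1.
- by move=> e c1 IH1 c2 IH2 s /and3P[_ w1 w2]; case: ifP; rewrite ?IH2 ?IH1.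
move=> x c IH s /and3P[_ nx wc].
by elim: {1}(regs s 2) => //= n IHn; rewrite IH //= upd_neq // eq_sym.
Qed.

Lemma keeps_cells d s s' a i v :
  keeps d s s' -> keeps d (set_cell s a i v) (set_cell s' a i v).
Proof. by case=> eqa eqr; split=> //=; rewrite eqa. Qed.

Lemma keeps_regs d s s' x v :
  keeps d s s' -> keeps d (set_reg s x v) (set_reg s' x v).
Proof.
by case=> eqa eqr; split=> //= y lty; rewrite !updE; case: ifP => // _; apply: eqr.
Qed.

(* The counter of a loop lives in register d, above the registers of the loop
   language and below all temporaries of the loop body. *)
Lemma ccompileP D c d s s1 : 2 < D -> D <= d -> cwf D c -> keeps D s s1 ->
  exists2 s', runs (ccompile d c) s1 (ctime c (regs s 2)) s' &
    keeps D (hsem c s) s' /\ forall x, D <= x < d -> regs s' x = regs s1 x.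
Proof.
move=> D2; elim: c d s s1 => /=.
- move=> x e d s s1 leD /and3P[ltx nx2 wfe] k1.
  have [||s2 r2 [k2 v2]] := @ecompileP e d s1; [by lia|exact: hwfW wfe|].
  have eqv : regs s2 d = heval (arrs s) (regs s) e.
    rewrite v2 k1.1; apply: heval_ext wfe => // y lty; exact: k1.2.
  exists (set_reg s2 x (regs s2 d)).
    apply: runs_seq; last exact: (runs_assign s2 x (Reg d)).
    by rewrite -(k1.2 2).
  split=> [|y /andP[ley lty] /=]; last first.
    by rewrite upd_neq ?k2.2 //; lia.
  by rewrite eqv; apply: keeps_regs; apply: keeps_trans k1 _; apply: keepsW k2.
- move=> a e1 e2 d s s1 leD /andP[wf1 wf2] k1.
  have [||s2 r2 [k2 v2]] := @ecompileP e1 d s1; [by lia|exact: hwfW wf1|].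
  have [||s3 r3 [k3 v3]] := @ecompileP e2 d.+1 s2; [by lia|by apply: hwfW wf2; lia|].
  have k12 : keeps D s s2 by apply: keeps_trans k1 _; apply: keepsW k2.
  have eqv1 : regs s3 d = heval (arrs s) (regs s) e1.
    rewrite k3.2 // v2 k1.1; apply: heval_ext wf1 => // y lty; exact: k1.2.
  have eqv2 : regs s3 d.+1 = heval (arrs s) (regs s) e2.
    rewrite v3 k12.1; apply: heval_ext wf2 => // y lty; exact: k12.2.
  exists (set_cell s3 a (regs s3 d) (regs s3 d.+1)).
    apply: runs_seq; first by rewrite -(k1.2 2) //; exact: r2.
    apply: runs_seq; first by rewrite -(k12.2 2) //; exact: r3.
    exact: (runs_write s3 a (Reg d) (Reg d.+1)).
  split=> [|y /andP[ley lty] /=]; last by rewrite k3.2 ?k2.2 //; lia.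
  rewrite eqv1 eqv2; apply: keeps_cells; apply: keeps_trans k12 _.
  by apply: keepsW k3; lia.
- move=> c1 IH1 c2 IH2 d s s1 leD /andP[wf1 wf2] k1.
  have [s2 r2 [k2 v2]] := IH1 d s s1 leD wf1 k1.
  have [s3 r3 [k3 v3]] := IH2 d _ s2 leD wf2 k2.
  exists s3; last by split=> // x lex; rewrite v3 ?v2.
  by apply: runs_seq r2 _; rewrite (cwf_hsem2 _ wf1) in r3.
- move=> e c1 IH1 c2 IH2 d s s1 leD /and3P[wf wf1 wf2] k1.
  have [||s2 r2 [k2 v2]] := @ecompileP e d s1; [by lia|exact: hwfW wf|].
  have eqv : regs s2 d = heval (arrs s) (regs s) e.
    rewrite v2 k1.1; apply: heval_ext wf => // y lty; exact: k1.2.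
  have k12 : keeps D s s2 by apply: keeps_trans k1 _; apply: keepsW k2.
  rewrite -eqv; case: ifP => [ne|eq0].
    have [s3 r3 [k3 v3]] := IH1 d s s2 leD wf1 k12.
    exists s3; last by split=> // x /andP[ge lt]; rewrite v3 ?k2.2 // ge.
    apply: runs_seq; first by rewrite -(k1.2 2) //; exact: r2.
    apply: (@runs_le _ _ (1 + ctime c1 (regs s 2)).+1); first by lia.
    by apply: runs_if; rewrite /= ne.
  have [s3 r3 [k3 v3]] := IH2 d s s2 leD wf2 k12.
  exists s3; last by split=> // x /andP[ge lt]; rewrite v3 ?k2.2 // ge.
  apply: runs_seq; first by rewrite -(k1.2 2) //; exact: r2.
  apply: (@runs_le _ _ (1 + ctime c2 (regs s 2)).+1); first by lia.
  by apply: runs_if; rewrite /= eq0.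
- move=> x c IH d s s1 leD /and3P[ltx nx2 wfc] k1.
  set n := regs s 2; pose f i s' := hsem c (set_reg s' x i); rewrite -/f.
  pose P i s' := [/\ i <= n, keeps D (iteri i f s) s', regs s' d = i &
    forall x, D <= x < d -> regs s' x = regs s1 x].
  have f2 i : regs (iteri i f s) 2 = n.
    by elim: i => //= i IHi; rewrite /f (cwf_hsem2 _ wfc) /= upd_neq // eq_sym.
  have [|||s2 r2] := @runs_while P (Defs.Sub (Reg 2) (Reg d))
    (Seq (Assign x (Reg d)) (Seq (ccompile d.+1 c) (Assign d (Add (Reg d) (Const 1)))))
    (2 + (ctime c n + 4)) n (set_reg s1 d 0).
  + by move=> i s' [lei k' eqd _] /=; rewrite eqd k'.2 // f2.
  + move=> i s' lti [lei k' eqd eqr].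
    have [|||s2 r2 [k2 v2]] := IH d.+1 (set_reg (iteri i f s) x i) (set_reg s' x i).
    * by lia.
    * by [].
    * exact: keeps_regs.
    exists (set_reg s2 d i.+1).
      apply: runs_seq.
        by have ra := runs_assign s' x (Reg d); rewrite /= eqd in ra; exact: ra.
      apply: runs_seq; first by rewrite [regs _ 2]upd_neq 1?eq_sym // f2 in r2; exact: r2.
      have -> : i.+1 = eval s2 (Add (Reg d) (Const 1)); last exact: runs_assign.
      by rewrite /= v2 /= ?upd_neq ?eqd ?addn1 //; lia.
    split=> //=.
    * exact: keeps_trans k2 (keeps_set _ _ _).
    * by rewrite upd_id.
    * by move=> y ley; rewrite upd_neq ?v2 /= ?upd_neq ?eqr //; lia.
  + split=> //=; first exact: keeps_trans k1 (keeps_set _ _ _).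
      by rewrite upd_id.
    by move=> y ley; rewrite upd_neq //; lia.
  move=> [_ k2 _ eqr2]; exists s2; last by split.
  apply: runs_seq; first exact: (runs_assign s1 d (Const 0)).
  by apply: runs_le r2 => /=; nia.
move=> d s s1 leD _ k1; exists s1 => //; exists 1 => //; exact: ExecSkip.
Qed.

(** * Polynomial running times *)

Definition polynomial_fun (f : nat -> nat) : Prop :=
  exists q : {poly nat}, forall n, f n = (q.[n])%R.

Lemma polynomial_fun_add f g : polynomial_fun f -> polynomial_fun g ->
  polynomial_fun (fun n => f n + g n).
Proof.
by move=> [p Ep] [q Eq]; exists (p + q)%R => n; rewrite hornerD -Ep -Eq.
Qed.

Lemma polynomial_fun_mul f g : polynomial_fun f -> polynomial_fun g ->
  polynomial_fun (fun n => f n * g n).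
Proof.
by move=> [p Ep] [q Eq]; exists (p * q)%R => n; rewrite hornerM -Ep -Eq.
Qed.

Lemma polynomial_fun_const c : polynomial_fun (fun=> c).
Proof. by exists (c%:P)%R => n; rewrite hornerC. Qed.

Lemma polynomial_fun_id : polynomial_fun id.
Proof. by exists 'X%R => n; rewrite hornerX. Qed.

Lemma etime_poly e : polynomial_fun (etime e).
Proof.
elim: e => /= *; repeat first [assumption | exact: polynomial_fun_const
  | exact: polynomial_fun_id | apply: polynomial_fun_add | apply: polynomial_fun_mul].
Qed.

Lemma ctime_poly c : polynomial_fun (ctime c).
Proof.
elim: c => /= *; repeat first [assumption | exact: etime_poly
  | exact: polynomial_fun_const | exact: polynomial_fun_id
  | apply: polynomial_fun_add | apply: polynomial_fun_mul].
Qed.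

(** * Labels of rows and columns *)

(* For weight 1 the pair (b, b) encodes e_b; for weight 2 the pair (b, c) with
   b <= c encodes e_b + e_c. *)
Definition labels (ent : seq nat) (al : nat) : seq (nat * nat) :=
  [seq u <- [seq (b, c) | b <- ent, c <- ent]
     | if al == 2 then u.1 <= u.2 else u.1 == u.2].

Definition vec (al : nat) (u : nat * nat) (v : nat) : nat :=
  (v == u.1) + ((al == 2) && (v == u.2)).

(** Membership of [w] in [AM] of the sum of the two encoded vectors; see [AM_approves]. *)
Definition approves (ent : seq nat) (al be : nat) (x y : nat * nat) (w : nat) : bool :=
  all (fun v => vec al x v + vec be y v <= vec al x w + vec be y w) ent.

Definition labelling (ent : seq nat) al K (x : nat -> nat * nat) : bool :=
  perm_eq (map x (iota 0 K)) (labels ent al).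

Definition dav_with (ent : seq nat) al be K L (H : nat -> nat -> nat) x y : Prop :=
  [/\ labelling ent al K x, labelling ent be L y &
      forall i j, i < K -> j < L -> approves ent al be (x i) (y j) (H i j)].

Definition dav (ent : seq nat) al be K L H : Prop := exists x y, dav_with ent al be K L H x y.

Lemma approvesC (ent : seq nat) al be x y w : approves ent al be x y w = approves ent be al y x w.
Proof. by apply: eq_all => v; rewrite (addnC (vec be y v)) (addnC (vec be y w)). Qed.

Lemma dav_with_tr (ent : seq nat) al be K L H x y :
  dav_with ent al be K L H x y -> dav_with ent be al L K (fun j i => H i j) y x.
Proof. by case=> lx ly ok; split=> // j i ltj lti; rewrite approvesC ok. Qed.

Lemma mem_labels (ent : seq nat) al u : (u \in labels ent al) =
  [&& u.1 \in ent, u.2 \in ent & if al == 2 then u.1 <= u.2 else u.1 == u.2].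
Proof.
case: u => b c; rewrite mem_filter /= andbC [RHS]andbA; congr andb.
apply/allpairsP/andP=> [[[b' c'] /= [h1 h2 [-> ->]]] //|[bE cE]].
by exists (b, c).
Qed.

Lemma labels_uniq (ent : seq nat) al : uniq ent -> uniq (labels ent al).
Proof.
by move=> uE; apply: filter_uniq; apply: allpairs_uniq => // -[? ?] [? ?] _ _.
Qed.

Lemma size_labels1 (ent : seq nat) : uniq ent -> size (labels ent 1) = size ent.
Proof.
move=> uE; rewrite -[RHS](size_map (fun b => (b, b))).
apply/perm_size/uniq_perm; rewrite ?labels_uniq ?map_inj_uniq //; first by move=> ? ? [].
move=> [b c]; rewrite mem_labels /=; apply/and3P/mapP=> [[bE _ /eqP <-]|[d dE [-> ->]]].
  by exists b.
by rewrite eqxx.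
Qed.

(** Among the p^2 ordered pairs, those with [u.1 <= u.2] and those with [u.2 <= u.1] are equally
    many by swapping; together they cover all pairs and they share the p diagonal ones. *)
Lemma size_labels2 (ent : seq nat) : uniq ent ->
  (size (labels ent 2)).*2 = size ent * (size ent).+1.
Proof.
move=> uE; set A := [seq (b, c) | b <- ent, c <- ent].
have szA : size A = size ent * size ent by rewrite size_allpairs.
have uA : uniq A by apply: allpairs_uniq => // -[? ?] [? ?] _ _.
have memA b c : ((b, c) \in A) = (b \in ent) && (c \in ent).
  by apply/allpairsP/andP=> [[[b' c'] /= [h1 h2 [-> ->]]] //|[bE cE]]; exists (b, c).
have swap : count (fun u => u.2 <= u.1) A = count (fun u => u.1 <= u.2) A.
  have /permP <- : perm_eq [seq (u.2, u.1) | u <- A] A.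
    apply: uniq_perm => //; first by rewrite map_inj_uniq // => [[? ?] [? ?]] [-> ->].
    move=> [b c]; rewrite memA; apply/mapP/andP=> [[[b' c'] + [-> ->]]|[bE cE]].
      by rewrite memA => /andP[].
    by exists (c, b); rewrite ?memA ?bE ?cE.
  by rewrite count_map.
have diag : count (fun u => u.1 == u.2) A = size ent.
  by rewrite -size_labels1 // size_filter.
have := count_predUI (fun u => u.1 <= u.2) (fun u => u.2 <= u.1) A.
rewrite swap (eq_count (a2 := predT)) ?count_predT; last first.
  by move=> u /=; rewrite leq_total.
rewrite (eq_count (a1 := predI _ _) (a2 := fun u => u.1 == u.2)); last first.
  by move=> u /=; rewrite -eqn_leq.
rewrite diag szA size_filter /= => E; rewrite -addnn -E mulnS; lia.
Qed.

(** Only the values p and p (p + 1) / 2 occur. Through this formula the dimensions of a voting form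
    become numbers of labels. *)
Lemma size_labels (ent : seq nat) al : uniq ent -> 0 < size ent -> 0 < al <= 2 ->
  size (labels ent al) = 'C(al + size ent - 1, size ent - 1).
Proof.
move=> uE p0 /andP[al0 al2].
have [->|->] : al = 1 \/ al = 2 by lia.
  by rewrite size_labels1 // addKn bin_sub // bin1.
have -> : 2 + size ent - 1 = (size ent).+1 by lia.
have -> : size ent - 1 = (size ent).+1 - 2 by lia.
apply: double_inj; rewrite size_labels2 // bin_sub; last by lia.
rewrite bin2 /= mulnC; have := odd_double_half ((size ent).+1 * size ent).
by rewrite oddM /= andNb add0n => ->.
Qed.

(** * Counting labels that contain a given candidate *)

Definition pairing (a c : nat) : nat * nat := if a <= c then (a, c) else (c, a).

Lemma pairing_inj a : injective (pairing a).
Proof.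
move=> c d; rewrite /pairing; case: ifP => h1; case: ifP => h2 [] //.
  by move=> *; lia.
by move=> *; lia.
Qed.

Lemma pairing_mem (ent : seq nat) (a : nat) c : a \in ent -> c \in ent ->
  pairing a c \in labels ent 2.
Proof.
move=> aE cE; rewrite /pairing mem_labels /=; case: ifP => h /=; rewrite aE cE //=; lia.
Qed.

(** A label containing [a] is determined by the partner of [a], so counting such labels amounts to
    counting candidates; this gives lower bounds here and upper bounds in the next lemma. *)
Lemma count_labels_ge (ent : seq nat) (a : nat) (C : seq nat) (P : pred (nat * nat)) :
  a \in ent -> uniq C -> {subset C <= ent} -> {in C, forall c, P (pairing a c)} ->
  size C <= count P (labels ent 2).
Proof.
move=> aE uC sC PC; rewrite -(size_map (pairing a)) -size_filter; apply: uniq_leq_size.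
  by rewrite map_inj_uniq //; apply: pairing_inj.
by move=> _ /mapP[c cC ->]; rewrite mem_filter PC //; apply: pairing_mem => //; apply: sC.
Qed.

Lemma count_labels_le (ent : seq nat) (a : nat) (C : seq nat) (P : pred (nat * nat)) :
  uniq ent ->
  {in labels ent 2, forall u, P u -> exists2 c, c \in C & u = pairing a c} ->
  count P (labels ent 2) <= size C.
Proof.
move=> uE PC; rewrite -(size_map (pairing a)) -size_filter; apply: uniq_leq_size.
  by rewrite filter_uniq // labels_uniq.
move=> u; rewrite mem_filter => /andP[Pu uL].
by have [c cC ->] := PC u uL Pu; apply: map_f.
Qed.

(** * Reading the label of a row off its repeated entries *)

Definition occ L (H : nat -> nat -> nat) i v := count (fun j => H i j == v) (iota 0 L).

(* The label of row [i] read off from the values that occur at least [th] times;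
   when there is none, column [j0] provides the label. *)
Definition row_guess (ent : seq nat) th j0 L H i (u : nat * nat) : Prop :=
  ((exists2 v, v \in ent & th <= occ L H i v) ->
    [/\ th <= occ L H i u.1, th <= occ L H i u.2, u.1 \in ent, u.2 \in ent &
      forall v, v \in ent -> th <= occ L H i v -> u.1 <= v <= u.2]) /\
  (~ (exists2 v, v \in ent & th <= occ L H i v) -> u = (H i j0, H i j0)).

(** If the components of [x] are the only values reaching the threshold, the least and the greatest
    such value are [x.1] and [x.2]. *)
Lemma row_guess_label (ent : seq nat) th j0 L H i u x : x.1 \in ent -> x.2 \in ent -> x.1 <= x.2 ->
  th <= occ L H i x.1 -> th <= occ L H i x.2 ->
  (forall v, v \in ent -> v != x.1 -> v != x.2 -> occ L H i v < th) ->
  row_guess ent th j0 L H i u -> u = x.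
Proof.
move=> x1E x2E le12 h1 h2 hlt [hv _].
have [|u1 u2 u1E u2E lim] := hv; first by exists x.1.
have mem v : v \in ent -> th <= occ L H i v -> v = x.1 \/ v = x.2.
  move=> vE hvv; case: (eqVneq v x.1) => [|n1]; first by left.
  case: (eqVneq v x.2) => [|n2]; first by right.
  by have := hlt v vE n1 n2; lia.
have := lim _ x1E h1; have := lim _ x2E h2.
by case: u {hv lim} u1 u2 u1E u2E => b c /= /mem mb /mem mc /mb b12 /mc c12 l1 l2;
  case: x {x1E x2E h1 h2 hlt mem mb mc} le12 b12 c12 l1 l2 => d e /= *;
  congr (_, _); lia.
Qed.

Section Occurrences.
Variables (ent : seq nat) (al be K L : nat) (H : nat -> nat -> nat).
Variables (x y : nat -> nat * nat) (i : nat).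
Hypotheses (uE : uniq ent) (D : dav_with ent al be K L H x y) (lti : i < K).
Hypothesis HE : forall j, j < L -> H i j \in ent.

Lemma label_mem : x i \in labels ent al.
Proof. by case: D => lx _ _; rewrite -(perm_mem lx) map_f // mem_iota. Qed.

(** Columns are in bijection with labels, and a column showing [v] in row [i] carries a label for
    which [v] is among the winners. *)
Lemma occ_le v : occ L H i v <= count (fun u => approves ent al be (x i) u v) (labels ent be).
Proof.
case: D => _ ly ok; rewrite -(permP ly) count_map /occ -!size_filter.
apply: uniq_leq_size; first by rewrite filter_uniq // iota_uniq.
move=> j; rewrite !mem_filter mem_iota /= => /andP[/eqP <- ltj].
by rewrite ltj andbT ok.
Qed.

(** A label for which [v] is the only possible winner forces its column to show [v]. The gap to the
    upper bound is due to ties. *)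
Lemma occ_ge v :
  count (fun u => all (fun w => approves ent al be (x i) u w ==> (w == v)) ent)
    (labels ent be) <= occ L H i v.
Proof.
case: D => _ ly ok; rewrite -(permP ly) count_map /occ -!size_filter.
apply: uniq_leq_size; first by rewrite filter_uniq // iota_uniq.
move=> j; rewrite !mem_filter mem_iota /= => /andP[/allP h ltj].
by rewrite ltj andbT; apply: (implyP (h _ (HE _))) => //; apply: ok.
Qed.

End Occurrences.

Lemma pairing_occurs a b v : a <= b -> (v == a) || (v == b) ->
  exists2 c, (c == a) || (c == b) & (a, b) = pairing v c.
Proof.
move=> leab /orP[]/eqP->; rewrite /pairing.
  by exists b; rewrite ?eqxx ?orbT ?leab.
exists a; rewrite ?eqxx //; case: ifP => // h.
by have -> : a = b by lia.
Qed.

Lemma size_predC1 (ent : seq nat) (a : nat) : uniq ent -> a \in ent ->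
  size [seq c <- ent | c != a] = (size ent).-1.
Proof. by move=> uE aE; rewrite -rem_filter // size_rem. Qed.

(** In a row labelled a, each of the p columns whose label contains a gives a a score of at least 2
    and every other candidate at most 1. Another candidate v wins only if the column contains v with
    a partner other than a, which leaves at most p - 1 columns. *)
Lemma row_guess12 (ent : seq nat) K L H x y j0 i u : uniq ent -> dav_with ent 1 2 K L H x y ->
  i < K -> (forall j, j < L -> H i j \in ent) ->
  row_guess ent (size ent) j0 L H i u -> u = x i.
Proof.
move=> uE D lti HE; have := label_mem D lti; rewrite mem_labels /=.
case/and3P=> aE _ /eqP e12.
have xE : x i = ((x i).1, (x i).1) by rewrite {2}e12; case: (x i).
set a := (x i).1 in aE e12 xE *.
have heavy : size ent <= occ L H i a.
  apply: leq_trans (occ_ge D lti HE a); apply: (@count_labels_ge _ a) => // c cE.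
  apply/allP => w wE; apply/implyP => /allP/(_ a aE); rewrite xE /vec /pairing /=.
  by case: ifP => h /=; case: (eqVneq w a) => //; lia.
apply: row_guess_label; rewrite -?e12 -/a // => v vE nva _.
apply: leq_ltn_trans (occ_le D lti v) _.
apply: (@leq_ltn_trans (size [seq c <- ent | c != a])); last first.
  by rewrite size_predC1 //; case: (ent) aE.
apply: (@count_labels_le _ v) => // [[b c]].
rewrite mem_labels /= => /and3P[bE cE lebc] /allP/(_ a aE); rewrite xE /vec /= => ok.
have [|d dbc ->] := @pairing_occurs b c v lebc; first by lia.
exists d => //; rewrite mem_filter; apply/andP; split; last first.
  by case/orP: dbc => /eqP->.
apply/eqP=> da; move: ok dbc; rewrite da.
case: (eqVneq v a) nva => // nva _; lia.
Qed.

(** In a row labelled (a, b), a column containing a with a partner other than b has a as its only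
    winner, and symmetrically for b; this gives p - 1 columns each, also when a = b. A third
    candidate v ties at best: if a = b only in the column (v, v), otherwise only in columns where
    the partner of v is neither a nor b, at most p - 2. *)
Lemma row_guess22 (ent : seq nat) K L H x y j0 i u : uniq ent -> 3 <= size ent ->
  dav_with ent 2 2 K L H x y ->
  i < K -> (forall j, j < L -> H i j \in ent) ->
  row_guess ent (size ent).-1 j0 L H i u -> u = x i.
Proof.
move=> uE p3 D lti HE; have := label_mem D lti; rewrite mem_labels /=.
case xE: (x i) => [a b] /= /and3P[aE bE leab].
have heavy v v' : v \in ent -> v' \in ent -> (v, v') = (a, b) \/ (v, v') = (b, a) ->
    (size ent).-1 <= occ L H i v.
  move=> vE v'E vv'; apply: leq_trans (occ_ge D lti HE v).
  rewrite -(size_predC1 uE v'E); apply: (@count_labels_ge _ v) => //.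
  - by rewrite filter_uniq.
  - by move=> c; rewrite mem_filter => /andP[].
  move=> c; rewrite mem_filter => /andP[ncv' cE].
  apply/allP => w wE; apply/implyP => /allP/(_ v vE); rewrite xE /vec /pairing /=.
  by case: vv' => [[<- <-]|[<- <-]]; case: ifP => h /=; case: (eqVneq w v) => //; lia.
apply: row_guess_label => //=.
- by apply: (heavy a b) => //; left.
- by apply: (heavy b a) => //; right.
move=> v vE nva nvb; apply: leq_ltn_trans (occ_le D lti v) _.
case: (eqVneq a b) => [eab|nab].
  (* One occurrence is below the threshold p - 1 because p >= 3. *)
  apply: (@leq_ltn_trans (size [:: v])); last by rewrite /=; lia.
  apply: (@count_labels_le _ v) => // [[c d]].
  rewrite mem_labels /= => /and3P[cE dE lecd] /allP/(_ a aE); rewrite xE /vec /= => ok.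
  exists v; first by rewrite inE.
  by rewrite /pairing leqnn; congr (_, _); lia.
apply: (@leq_ltn_trans (size [seq c <- [seq c <- ent | c != a] | c != b])); last first.
  rewrite size_predC1 ?filter_uniq // ?mem_filter 1?eq_sym ?nab // size_predC1 //.
  by case: (size ent) p3 => [|[|]].
apply: (@count_labels_le _ v) => // [[c d]].
rewrite mem_labels /= => /and3P[cE dE lecd] ok0.
move/allP/(_ a aE): (ok0); move/allP/(_ b bE): ok0; rewrite xE /vec /= => okb oka.
rewrite (negbTE nva) (negbTE nvb) !eqxx in oka okb.
have [|e ecd Ecd] := @pairing_occurs c d v lecd.
  by move: oka; case: (v == c); case: (v == d).
exists e => //; rewrite !mem_filter.
have [-> nae nbe] : [/\ e \in ent, e != a & e != b]; last by rewrite nae nbe.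
split; first by case/orP: ecd => /eqP->.
  apply/eqP=> ea; move: Ecd oka; rewrite ea /pairing.
  by case: ifP => _ [-> ->]; rewrite !eqxx (negbTE nva); case: (a == b); case: (a == v).
apply/eqP=> eb; move: Ecd okb; rewrite eb /pairing.
by case: ifP => _ [-> ->]; rewrite !eqxx (negbTE nvb); case: (b == a); case: (b == v).
Qed.

(** The label of the row has score at least 1, so another candidate can win only by a tie, in the
    one column that it labels. *)
Lemma occ11_le1 (ent : seq nat) K L H x y i v : uniq ent -> dav_with ent 1 1 K L H x y ->
  i < K -> v != (x i).1 -> occ L H i v <= 1.
Proof.
move=> uE D lti nv; have := label_mem D lti; rewrite mem_labels /= => /and3P[aE _ _].
apply: leq_trans (occ_le D lti v) _; rewrite -size_filter.
apply: (@uniq_leq_size _ _ [:: (v, v)]); first by rewrite filter_uniq // labels_uniq.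
move=> [b c]; rewrite mem_filter mem_labels /= => /andP[/allP/(_ _ aE) + /and3P[_ _ /eqP <-]].
by rewrite /vec /= inE => ok; apply/eqP; congr (_, _); lia.
Qed.

Lemma row_guess11_heavy (ent : seq nat) K L H x y j0 i u : uniq ent ->
  dav_with ent 1 1 K L H x y -> i < K ->
  (exists2 v, v \in ent & 2 <= occ L H i v) ->
  row_guess ent 2 j0 L H i u -> u = x i.
Proof.
move=> uE D lti hv [/(_ hv)[u1 u2 _ _ _] _].
have := label_mem D lti; rewrite mem_labels /= => /and3P[_ _ /eqP e12].
have eqx w : 1 < occ L H i w -> w = (x i).1.
  move=> gt1; apply/eqP; apply: contraTT gt1; rewrite -leqNgt.
  exact: (occ11_le1 uE D).
by case: u u1 u2 (x i) e12 eqx => [b c] /= ub uc [d e] /= <- h; rewrite (h _ ub) (h _ uc).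
Qed.

(* In a row labelled a, the column labelled a contains a; without repetitions, no
   other column does, so the entry of any other column can only be its own label. *)
Lemma distinct_row11 (ent : seq nat) K L H x y i j : uniq ent ->
  dav_with ent 1 1 K L H x y -> i < K -> j < L -> (forall j, j < L -> H i j \in ent) ->
  ~ (exists2 v, v \in ent & 2 <= occ L H i v) -> (H i j, H i j) = y j.
Proof.
move=> uE D lti ltj HE nh.
have := label_mem D lti; have := label_mem (dav_with_tr D) ltj.
rewrite !mem_labels /= => /and3P[bE _ /eqP yE] /and3P[aE _ /eqP xE].
case: (D) => _ ly ok; set a := (x i).1 in xE aE; set b := (y j).1 in yE bE.
have yjE : y j = (b, b) by rewrite {2}yE [LHS]surjective_pairing.
have xiE : x i = (a, a) by rewrite {2}xE [LHS]surjective_pairing.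
have [ja ltja yja] : exists2 j, j < L & y j = (a, a).
  have : (a, a) \in map y (iota 0 L) by rewrite (perm_mem ly) mem_labels /= aE eqxx.
  by case/mapP=> j' + E; rewrite mem_iota /= => ltj'; exists j'.
have Ha : H i ja = a.
  have /allP/(_ a aE) := ok _ _ lti ltja; rewrite xiE yja /vec /=; lia.
rewrite yjE; suff -> : H i j = b by [].
have /allP/(_ a aE) := ok _ _ lti ltj; rewrite xiE yjE /vec /= => okj.
apply/eqP; apply: contraT => nb.
have Hj : H i j = a by lia.
case: nh; exists a => //; rewrite /occ -size_filter.
apply: (@uniq_leq_size _ [:: j; ja]).
  rewrite /= inE andbT; apply: contra nb => /eqP ej.
  by move: yja; rewrite -ej yjE Hj => -[->].
by move=> j'; rewrite !inE mem_filter mem_iota => /orP[]/eqP->; rewrite ?Hj ?Ha eqxx.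
Qed.

(** The threshold and the column are bounded by [K * L] because the program tries them as loop
    counters. *)
Lemma dav_guess (ent : seq nat) al be K L H x y :
  uniq ent -> 3 <= size ent -> 0 < al <= 2 -> 0 < be <= 2 ->
  K = size (labels ent al) -> L = size (labels ent be) ->
  (forall i j, i < K -> j < L -> H i j \in ent) ->
  dav_with ent al be K L H x y ->
  (exists th j0, [/\ th < K * L, j0 < K * L &
     forall i u, i < K -> row_guess ent th j0 L H i u -> u = x i]) \/
  (exists th j0, [/\ th < K * L, j0 < K * L &
     forall j u, j < L -> row_guess ent th j0 K (fun j i => H i j) j u -> u = y j]).
Proof.
move=> uE p3 al2 be2 EK EL HE D.
have sz2 : size ent < size (labels ent 2) by have := size_labels2 uE; nia.
have [K3 L3] : size ent <= K /\ size ent <= L.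
  rewrite EK EL; split.
    by have [->|->] : al = 1 \/ al = 2 by [lia|]; rewrite ?size_labels1 //; lia.
  by have [->|->] : be = 1 \/ be = 2 by [lia|]; rewrite ?size_labels1 //; lia.
have [al1|al_2] : al = 1 \/ al = 2 by lia.
  have [be1|be_2] : be = 1 \/ be = 2 by lia.
    subst al be; pose heavy i := has (fun v => 2 <= occ L H i v) ent.
    case: (boolP (all heavy (iota 0 K))) => [/allP hall|].
      left; exists 2, 0; split; [by nia|by nia|].
      move=> i u lti; apply: (row_guess11_heavy uE D lti).
      by apply/hasP; apply: hall; rewrite mem_iota.
    (* One row [i0] without repetitions suffices: after transposition it is the guessed column,
       consulted only for those columns of the matrix in which nothing repeats. *)
    rewrite -has_predC => /hasP[i0]; rewrite mem_iota /= => lti0 nh; right.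
    exists 2, i0; split; [by nia|by nia|].
    move=> j u ltj rg.
    case: (boolP (has (fun v => 2 <= occ K (fun j i => H i j) j v) ent)) => [/hasP hj|/hasP hj].
      exact: (row_guess11_heavy uE (dav_with_tr D) ltj hj rg).
    rewrite rg.2 //; apply: (distinct_row11 uE D lti0 ltj).
      by move=> j' ltj'; apply: HE.
    by move=> hv; move/negP: nh; apply; apply/hasP.
  subst al be; left; exists (size ent), 0; split; [by nia|by nia|].
  by move=> i u lti; apply: (row_guess12 uE D lti) => j ltj; apply: HE.
have [be1|be_2] : be = 1 \/ be = 2 by lia.
  subst al be; right; exists (size ent), 0; split; [by nia|by nia|].
  by move=> j u ltj; apply: (row_guess12 uE (dav_with_tr D) ltj) => i lti; apply: HE.
subst al be; left; exists (size ent).-1, 0; split; [by nia|by nia|].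
by move=> i u lti; apply: (row_guess22 uE p3 D lti) => j ltj; apply: HE.
Qed.

(** * Perfect matchings by auction *)

Section Auction.
Variables (T : eqType) (lab : seq T) (L : nat) (adj : T -> nat -> bool).
Hypotheses (lab_uniq : uniq lab) (adj_lt : forall u j, adj u j -> j < L).

Definition assigned (pr : nat -> nat) (ow : nat -> T) (u : T) : bool :=
  has (fun j => (0 < pr j) && (ow j == u)) (iota 0 L).

(* Column j is owned by the bidder ow j as soon as its price pr j is positive.  The
   owner paid at most 1 more than the cheapest of its columns costs now. *)
Definition auction_inv (pr : nat -> nat) (ow : nat -> T) : Prop :=
  [/\ forall j, j < L -> 0 < pr j ->
        [/\ ow j \in lab, adj (ow j) j & forall j', adj (ow j) j' -> pr j <= (pr j').+1],
      forall i j, i < L -> j < L -> 0 < pr i -> 0 < pr j -> ow i = ow j -> i = j &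
      forall j, j < L -> pr j <= L.+1].

Definition bid u j (pr : nat -> nat) (ow : nat -> T) pr' ow' : Prop :=
  [/\ u \in lab, ~~ assigned pr ow u, adj u j, pr j <= L &
     [/\ forall j', adj u j' -> pr j <= pr j',
         forall j', pr' j' = if j' == j then (pr j).+1 else pr j' &
         forall j', ow' j' = if j' == j then u else ow j']].

(** Prices never fall, so what an owner paid stays within 1 of its cheapest option; the new owner
    has just paid 1 more than its minimum. As the bidder owned nothing, no label gets two
    columns. *)
Lemma bid_inv u j pr ow pr' ow' :
  bid u j pr ow pr' ow' -> auction_inv pr ow -> auction_inv pr' ow'.
Proof.
move=> [uL nu auj lepr [minj Epr Eow]] [I1 I2 I3].
have le_pr j' : pr j' <= pr' j' by rewrite Epr; case: eqP => // ->.
have nown i : i < L -> 0 < pr i -> ow i != u.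
  move=> lti pi; apply: contra nu => /eqP <-; apply/hasP; exists i; rewrite ?mem_iota //.
  by rewrite pi eqxx.
split.
- move=> i lti; rewrite Epr Eow; case: eqP => [-> _|_ pi].
    split=> // j' auj'; rewrite ltnS; apply: leq_trans (le_pr _); exact: minj.
  have [ow1 ow2 ow3] := I1 i lti pi; split=> // j' /ow3 le1.
  by apply: leq_trans le1 _; rewrite ltnS.
- move=> i i' lti lti'; rewrite !Epr !Eow.
  case: eqP => [->|_]; case: eqP => [->|_] // pi pi'.
  + by move/esym => E; have := nown _ lti' pi'; rewrite E eqxx.
  + by move=> E; have := nown _ lti pi; rewrite E eqxx.
  + exact: I2.
- by move=> i lti; rewrite Epr; case: eqP => // _; apply: I3.
Qed.

(** The sum of the prices is the potential that bounds the number of bids. *)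
Lemma bid_sum u j pr ow pr' ow' : bid u j pr ow pr' ow' ->
  \sum_(i < L) pr' i = (\sum_(i < L) pr i).+1.
Proof.
move=> [_ _ /adj_lt ltj _ [_ Epr _]].
rewrite (bigD1 (Ordinal ltj)) //= [in RHS](bigD1 (Ordinal ltj)) //=.
rewrite Epr eqxx -addSn; congr (_ + _); apply: eq_bigr => i ni.
by rewrite Epr; case: eqP => // E; case/eqP: ni; apply: val_inj.
Qed.

(* If all columns wanted by an unassigned bidder cost more than L, then, a matching
   m being injective, there are strictly more columns of price >= t than of price
   >= t.+1 for each t <= L: the bidders owning the latter, and u, are matched
   to the former. *)
Lemma auction_not_stuck pr ow u (m : T -> nat) :
  auction_inv pr ow -> u \in lab -> ~~ assigned pr ow u ->
  {in lab, forall v, adj v (m v)} -> {in lab &, injective m} ->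
  exists2 j, adj u j & pr j <= L.
Proof.
move=> [I1 I2 I3] uL nu am inj_m.
case: (boolP (has (fun j => adj u j && (pr j <= L)) (iota 0 L))) => [/hasP[j _ /andP[]]|].
  by exists j.
move=> /hasPn stuck.
have wants j : adj u j -> L < pr j.
  move=> auj; have := stuck j; rewrite mem_iota /= auj /= -ltnNge; apply.
  exact: (adj_lt auj).
pose lev t := [seq j <- iota 0 L | t <= pr j].
have step t : t <= L -> size (lev t.+1) < size (lev t).
  move=> leL.
  have memlev j : j \in lev t.+1 -> [/\ j < L, 0 < pr j & t < pr j].
    by rewrite mem_filter mem_iota /= => /andP[lt ltj]; split=> //; lia.
  have sZ : {subset u :: map ow (lev t.+1) <= lab}.
    move=> v; rewrite inE => /orP[/eqP->//|/mapP[j /memlev[ltj p _] ->]].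
    by have [] := I1 j ltj p.
  rewrite -[size (lev t.+1)](size_map ow) -/(size (u :: _)) -(size_map m).
  apply: uniq_leq_size; first rewrite map_inj_in_uniq.
  - rewrite cons_uniq; apply/andP; split.
      apply: contra nu => /mapP[j /memlev[ltj p _] ->]; apply/hasP.
      by exists j; rewrite ?mem_iota // p eqxx.
    rewrite map_inj_in_uniq ?filter_uniq ?iota_uniq // => i j.
    by move=> /memlev[lti pi _] /memlev[ltj pj _]; apply: I2.
  - by move=> v w /sZ vL /sZ wL; apply: inj_m.
  move=> _ /mapP[v vZ ->]; have vL := sZ v vZ.
  have amv := am v vL; rewrite mem_filter mem_iota /= (adj_lt amv) andbT.
  move: vZ; rewrite inE => /orP[/eqP Ev|/mapP[j /memlev[ltj p ltt] Ev]].
    by move: amv; rewrite Ev => /wants; lia.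
  by have [_ _ /(_ (m v))] := I1 j ltj p; rewrite -Ev => /(_ amv); lia.
(* Level 0 has L columns and each level loses at least one, so there is no room for L + 1
   descents. *)
have big t : t <= L.+1 -> size (lev t) + t <= L.
  elim: t => [_|t IH lt]; last by have := step t lt; have := IH (ltnW lt); lia.
  by rewrite addn0 size_filter -{2}(size_iota 0 L) count_size.
by have := big L.+1 (leqnn _); lia.
Qed.

(** The number of rounds is fixed in advance, so idle rounds must be allowed. An idle round carries
    its reason: the auction is complete, or some bidder is stuck, which [auction_not_stuck] excludes
    when a perfect matching exists. *)
Definition auction_step pr ow pr' ow' : Prop :=
  (exists u j, bid u j pr ow pr' ow') \/
  [/\ pr' =1 pr, ow' =1 ow &
     {in lab, forall u, assigned pr ow u} \/
     exists u, [/\ u \in lab, ~~ assigned pr ow u & forall j, adj u j -> L < pr j]].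

Lemma auction_step_inv pr ow pr' ow' :
  auction_step pr ow pr' ow' -> auction_inv pr ow -> auction_inv pr' ow'.
Proof.
case=> [[u [j]] /bid_inv //|[Epr Eow _] [I1 I2 I3]]; split.
- move=> j ltj; rewrite Epr Eow => /(I1 j ltj)[h1 h2 h3]; split=> // j'.
  by rewrite Epr; apply: h3.
- by move=> i j lti ltj; rewrite !Epr !Eow; apply: I2.
- by move=> j ltj; rewrite Epr; apply: I3.
Qed.

Lemma assigned_ext pr ow pr' ow' u :
  pr' =1 pr -> ow' =1 ow -> assigned pr' ow' u = assigned pr ow u.
Proof. by move=> Epr Eow; apply: eq_has => j; rewrite Epr Eow. Qed.

Lemma auction_step_progress pr ow pr' ow' m n :
  {in lab, forall v, adj v (m v)} -> {in lab &, injective m} ->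
  auction_inv pr ow -> auction_step pr ow pr' ow' ->
  {in lab, forall u, assigned pr ow u} \/ n <= \sum_(i < L) pr i ->
  {in lab, forall u, assigned pr' ow' u} \/ n < \sum_(i < L) pr' i.
Proof.
move=> am inj_m I [[u [j B]]|[Epr Eow stop]].
  have := bid_sum B; case: B => [uL nu _ _ _] -> [/(_ u uL)|]; last by right.
  by rewrite (negbTE nu).
case: stop => [done _|[u [uL nu stuck]] _].
  by left=> u uL; rewrite (assigned_ext _ Epr Eow) done.
have [j auj] := auction_not_stuck I uL nu am inj_m.
by have := stuck j auj; lia.
Qed.

Lemma auction_sum_le pr ow : auction_inv pr ow -> \sum_(i < L) pr i <= L * L.+1.
Proof.
case=> _ _ I3; apply: (@leq_trans (\sum_(i < L) L.+1)).
  by apply: leq_sum => i _; apply: I3.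
by rewrite sum_nat_const card_ord.
Qed.

(** The value [ow j] means nothing while the price of [j] is 0. When all L labels own a column,
    pigeonhole makes [ow] a bijection, so the column at which [ow j] is really owned can only be
    [j]. *)
Lemma auction_all_assigned pr ow : size lab = L -> auction_inv pr ow ->
  {in lab, forall u, assigned pr ow u} ->
  perm_eq (map ow (iota 0 L)) lab /\ forall j, j < L -> adj (ow j) j.
Proof.
move=> szL [I1 I2 I3] done.
have sub : {subset lab <= map ow (iota 0 L)}.
  by move=> u uL; have /hasP[j jL /andP[_ /eqP <-]] := done u uL; apply: map_f.
have le_sz : size (map ow (iota 0 L)) <= size lab by rewrite size_map size_iota szL.
have um := leq_size_uniq lab_uniq sub le_sz.
have perm : perm_eq (map ow (iota 0 L)) lab.
  rewrite perm_sym; apply: uniq_perm => //.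
  by have [] := uniq_min_size lab_uniq sub le_sz.
split=> // j ltj.
have owjL : ow j \in lab by rewrite -(perm_mem perm) map_f // mem_iota.
have /hasP[j'] := done _ owjL; rewrite mem_iota /= => ltj' /andP[p' /eqP Eow].
have [_ + _] := I1 j' ltj' p'; rewrite Eow.
suff -> : j' = j by [].
have ix i : i < L -> nth (ow 0) (map ow (iota 0 L)) i = ow i.
  by move=> lti; rewrite (nth_map 0) ?size_iota // nth_iota.
apply/eqP; rewrite -(nth_uniq (ow 0) _ _ um) ?size_map ?size_iota //.
by rewrite !ix // Eow.
Qed.

End Auction.

(** * Labels encode strategies *)

Lemma sum_delta (ent : seq nat) b : b \in ent ->
  \sum_(a : seq_sub ent) (ssval a == b : nat) = 1.
Proof.
move=> bE; rewrite (bigD1 (SeqSub bE)) //= eqxx big1 // => a na.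
by apply/eqP; rewrite eqb0; apply: contra na => /eqP E; apply/eqP/val_inj.
Qed.

Lemma vec_sum (ent : seq nat) al u : 0 < al <= 2 -> u \in labels ent al ->
  \sum_(a : seq_sub ent) [ffun a : seq_sub ent => vec al u (ssval a)] a == al.
Proof.
move=> al2; rewrite mem_labels => /and3P[bE cE _].
under eq_bigr do rewrite ffunE.
rewrite big_split /= sum_delta //.
have [->|->] : al = 1 \/ al = 2 by lia.
  by rewrite big1.
by under eq_bigr do rewrite eqxx /=; rewrite sum_delta.
Qed.

Lemma sum_succ_split (A : finType) (f : A -> nat) n : \sum_a f a = n.+1 ->
  exists b (f' : A -> nat), (forall a, f a = (a == b) + f' a) /\ \sum_a f' a = n.
Proof.
move=> Ef; have [b fb] : exists b, 0 < f b.
  case: (pickP (fun b => 0 < f b)) => [b fb|f0]; first by exists b.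
  by move: Ef; rewrite big1 // => a _; have := f0 a; lia.
exists b, (fun a => f a - (a == b)); split=> [a|].
  by case: eqP => [->|_] /=; lia.
have [E1 E2] : \sum_a f a = f b + \sum_(a | a != b) f a /\
   \sum_a (f a - (a == b)) = f b - 1 + \sum_(a | a != b) f a.
  rewrite (bigD1 b) //= [in X in _ /\ X](bigD1 b) //= eqxx; split=> //.
  by congr (_ + _); apply: eq_bigr => a /negbTE->; rewrite subn0.
by lia.
Qed.

(** Splitting off one unit [al] times leaves the zero vector. The conclusion is boolean so that
    [xchoose] can turn it into a function on strategies. *)
Lemma strategy_label (ent : seq nat) al (st : strategy (seq_sub ent) al) :
  0 < al <= 2 ->
  exists u, (u \in labels ent al) && [forall a, val st a == vec al u (ssval a)].
Proof.
move=> al2; case: st => f /= /eqP.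
have [->|->] : al = 1 \/ al = 2 by lia.
  move=> /sum_succ_split[b [f' [Ef /eqP]]]; rewrite sum_nat_eq0 => /forallP f'0.
  exists (ssval b, ssval b); rewrite mem_labels /= eqxx (ssvalP b) /=.
  apply/forallP=> a; rewrite /vec /= Ef.
  by rewrite (eqP (implyP (f'0 a) isT)) -(inj_eq val_inj).
move=> /sum_succ_split[b [f' [Ef /sum_succ_split[c [f'' [Ef' /eqP]]]]]].
rewrite sum_nat_eq0 => /forallP f''0.
have Efa a : f a = (ssval a == ssval b) + (ssval a == ssval c).
  rewrite Ef Ef' (eqP (implyP (f''0 a) isT)) addn0.
  by rewrite -[a == b](inj_eq val_inj) -[a == c](inj_eq val_inj).
case: (leqP (ssval b) (ssval c)) => h.
  exists (ssval b, ssval c); rewrite mem_labels /= h !ssvalP /=.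
  by apply/forallP=> a; rewrite /vec Efa.
exists (ssval c, ssval b); rewrite mem_labels /= (ltnW h) !ssvalP /=.
by apply/forallP=> a; rewrite /vec Efa addnC.
Qed.

(** The smaller of the two least components would have a positive coordinate in one vector and 0 in
    the other; once these components agree, they cancel and the others agree too. *)
Lemma vec_inj (ent : seq nat) al : 0 < al <= 2 ->
  {in labels ent al &, forall u u', {in ent, vec al u =1 vec al u'} -> u = u'}.
Proof.
move=> al2 [b c] [d e]; rewrite !mem_labels /=.
move=> /and3P[bE cE leu] /and3P[dE eE leu'] E.
have [eq_al|eq_al] : al = 1 \/ al = 2 by lia.
  move: leu leu' (E b bE); rewrite eq_al /vec /= => /eqP <- /eqP <-.
  by rewrite eqxx; case: eqP => // ->.
rewrite eq_al /vec /= in leu leu' E.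
case: (ltngtP b d) => [lt_bd|lt_db|bd].
- have := E b bE; rewrite eqxx (ltn_eqF lt_bd) (ltn_eqF (leq_trans lt_bd leu')).
  by [].
- have := E d dE; rewrite eqxx (ltn_eqF lt_db) (ltn_eqF (leq_trans lt_db leu)).
  by [].
by have := E c cE; rewrite bd eqxx => /addnI; case: eqP => // ->.
Qed.

Lemma AM_approves (ent : seq nat) al be (x : strategy (seq_sub ent) al)
    (y : strategy (seq_sub ent) be) u u' (w : seq_sub ent) :
  (forall a, val x a = vec al u (ssval a)) -> (forall a, val y a = vec be u' (ssval a)) ->
  (w \in AM (fun a => val x a + val y a)) = approves ent al be u u' (ssval w).
Proof.
move=> Ex Ey; rewrite inE eqn_leq (leq_bigmax w) /=.
apply/bigmax_leqP/allP => [h v vE|h a _].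
  by have := h (SeqSub vE) isT; rewrite !Ex !Ey.
by rewrite !Ex !Ey; apply: h; apply: ssvalP.
Qed.

Lemma labelling_of_inj (ent : seq nat) al K x : uniq ent -> K = size (labels ent al) ->
  (forall i, i < K -> x i \in labels ent al) ->
  (forall i j, i < K -> j < K -> x i = x j -> i = j) -> labelling ent al K x.
Proof.
move=> uE EK xL xI.
have um : uniq (map x (iota 0 K)).
  rewrite map_inj_in_uniq ?iota_uniq // => i j.
  by rewrite !mem_iota /=; apply: xI.
apply: uniq_perm => //; first exact: labels_uniq.
have [||//] := @uniq_min_size _ _ (labels ent al) um.
  by move=> u /mapP[i + ->]; rewrite mem_iota; apply: xL.
by rewrite size_map size_iota EK.
Qed.

Lemma labelling_mem (ent : seq nat) al K x i :
  labelling ent al K x -> i < K -> x i \in labels ent al.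
Proof. by move=> lx lti; rewrite -(perm_mem lx) map_f // mem_iota. Qed.

Lemma labelling_inj (ent : seq nat) al K x i j : uniq ent ->
  labelling ent al K x -> i < K -> j < K -> x i = x j -> i = j.
Proof.
move=> uE lx lti ltj E.
have um : uniq (map x (iota 0 K)) by rewrite (perm_uniq lx) labels_uniq.
have ix m : m < K -> nth (x 0) (map x (iota 0 K)) m = x m.
  by move=> ltm; rewrite (nth_map 0) ?size_iota // nth_iota.
apply/eqP; rewrite -(nth_uniq (x 0) _ _ um) ?size_map ?size_iota //.
by rewrite !ix // E.
Qed.

(** This is how the program, which knows only p and the dimensions, finds the weights. *)
Lemma weight_neq2 (ent : seq nat) w M : uniq ent -> 3 <= size ent -> 0 < w <= 2 ->
  M = size (labels ent w) -> (M != size ent) = (w == 2).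
Proof.
move=> uE p3 w2 ->; have [->|->] : w = 1 \/ w = 2 by lia.
  by rewrite size_labels1 // eqxx.
rewrite eqxx; apply/eqP => E; have := size_labels2 uE.
by rewrite E -muln2 => /eqP; rewrite eqn_pmul2l; move: p3; case: (size ent) => [|[|[|]]].
Qed.

Lemma size_labels_ge (ent : seq nat) w : uniq ent -> 0 < w <= 2 ->
  size ent <= size (labels ent w).
Proof.
move=> uE w2; have [->|->] : w = 1 \/ w = 2 by lia.
  by rewrite size_labels1.
have := size_labels2 uE; rewrite -muln2; nia.
Qed.

Section Strategies.
Variables (ent : seq nat) (al K : nat).
Hypotheses (uE : uniq ent) (al2 : 0 < al <= 2) (EK : K = size (labels ent al)).

Lemma strategies_labelling (x : 'I_K -> strategy (seq_sub ent) al) : bijective x ->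
  exists2 X, labelling ent al K X &
    forall (i : 'I_K) a, val (x i) a = vec al (X i) (ssval a).
Proof.
move=> bx; pose lab_of st := xchoose (@strategy_label ent al st al2).
have labP st : (lab_of st \in labels ent al) /\
    forall a, val st a = vec al (lab_of st) (ssval a).
  have /andP[h1 /forallP h2] := xchooseP (@strategy_label ent al st al2).
  by split=> // a; apply/eqP.
(* Indices outside the range get a dummy label that is never inspected. *)
pose X i := if insub i is Some i' then lab_of (x i') else (0, 0).
have XE (i : 'I_K) : X i = lab_of (x i) by rewrite /X valK.
exists X; last by move=> i a; rewrite XE; apply: (labP _).2.
apply: labelling_of_inj => // [i lti|i j lti ltj].
  by rewrite (XE (Ordinal lti)); apply: (labP _).1.
rewrite (XE (Ordinal lti)) (XE (Ordinal ltj)) => E.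
suff: Ordinal lti = Ordinal ltj by case.
apply: (bij_inj bx); apply/val_inj/ffunP => a.
by rewrite (labP _).2 E -(labP _).2.
Qed.

Lemma labelling_strategies X : labelling ent al K X ->
  exists2 x : 'I_K -> strategy (seq_sub ent) al, bijective x &
    forall (i : 'I_K) a, val (x i) a = vec al (X i) (ssval a).
Proof.
move=> lX; have XL (i : 'I_K) : X i \in labels ent al by apply: labelling_mem lX _.
pose x (i : 'I_K) : strategy (seq_sub ent) al := 
  exist (fun f : {ffun seq_sub ent -> nat} => \sum_a f a == al)
    [ffun a => vec al (X i) (ssval a)] (vec_sum al2 (XL i)).
have xE (i : 'I_K) a : val (x i) a = vec al (X i) (ssval a) by rewrite /= ffunE.
exists x => //.
have surj (st : strategy (seq_sub ent) al) : exists i, val (x i) == val st.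
  have [u /andP[]] := strategy_label st al2.
  rewrite -(perm_mem lX) => /mapP[i + ->]; rewrite mem_iota /= => lti /forallP h.
  exists (Ordinal lti); apply/eqP/ffunP => a; rewrite xE; apply/esym/eqP; exact: h.
have inj_x : injective x.
  move=> i j E; apply/ord_inj/(labelling_inj uE lX) => //.
  apply: (vec_inj al2 (XL i) (XL j)) => v vE.
  by have := xE i (SeqSub vE); rewrite E xE.
exists (fun st => xchoose (surj st)) => [i|st].
  by apply: inj_x; apply: val_inj; apply/eqP; apply: (xchooseP (surj (x i))).
by apply: val_inj; apply/eqP; apply: (xchooseP (surj st)).
Qed.

End Strategies.

(** * The matrix as stored in memory, and DAV forms in terms of labels *)

Definition cell k l (g : 'M[nat]_(k, l)) i j := nth 0 (row_major g) (i * l + j).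

Lemma nth_flatten_const (T : Type) (x0 : T) l (ss : seq (seq T)) i j :
  all (fun s => size s == l) ss -> i < size ss -> j < l ->
  nth x0 (flatten ss) (i * l + j) = nth x0 (nth [::] ss i) j.
Proof.
elim: ss i => // s ss IH i /= /andP[/eqP szs szss] lti ltj.
rewrite nth_cat szs; case: i lti => [|i] lti /=; first by rewrite ltj.
rewrite -IH //; case: ifP => h; first by nia.
by congr nth; nia.
Qed.

Lemma cellE k l (g : 'M[nat]_(k, l)) (i : 'I_k) (j : 'I_l) : cell g i j = g i j.
Proof.
rewrite /cell /row_major nth_flatten_const ?size_map -?enumT ?size_enum_ord //; last first.
  by apply/allP => _ /mapP[i' _ ->]; rewrite size_map size_enum_ord.
rewrite (nth_map i) ?size_enum_ord // nth_ord_enum.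
by rewrite (nth_map j) ?size_enum_ord // nth_ord_enum.
Qed.

Lemma size_row_major k l (g : 'M[nat]_(k, l)) : size (row_major g) = k * l.
Proof. by rewrite size_allpairs !size_enum_ord. Qed.

Lemma cell_entries k l (g : 'M[nat]_(k, l)) i j : i < k -> j < l -> cell g i j \in entries g.
Proof. by move=> lti ltj; rewrite (cellE g (Ordinal lti) (Ordinal ltj)) mem_entries. Qed.

Lemma ncandE k l (g : 'M[nat]_(k, l)) : ncand g = size (entries g).
Proof. by rewrite /ncand card_seq_sub // undup_uniq. Qed.

Lemma DAV_formE k l (g : 'M[nat]_(k, l)) al be : 0 < al <= 2 -> 0 < be <= 2 ->
  k = size (labels (entries g) al) -> l = size (labels (entries g) be) ->
  DAV_form g al be <-> dav (entries g) al be k l (cell g).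
Proof.
move=> al2 be2 Ek El; have uE : uniq (entries g) by apply: undup_uniq.
split=> [[x [y [bx by_ ok]]]|[X [Y [lX lY ok]]]].
  have [X lX EX] := strategies_labelling uE al2 Ek bx.
  have [Y lY EY] := strategies_labelling uE be2 El by_.
  exists X, Y; split=> // i j lti ltj.
  rewrite (cellE g (Ordinal lti) (Ordinal ltj)).
  by have := ok (Ordinal lti) (Ordinal ltj); rewrite (AM_approves _ (EX _) (EY _)).
have [x bx Ex] := labelling_strategies uE al2 lX.
have [y by_ Ey] := labelling_strategies uE be2 lY.
exists x, y; split=> // i j.
by rewrite (AM_approves (entry g i j) (Ex i) (Ey j)) /= -cellE ok.
Qed.

(** * Derived expressions *)

Definition holds (ar : nat -> nat -> nat) (rg : nat -> nat) (e : hexp) : bool :=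
  heval ar rg e != 0.

Definition hnot e := HIf e (HC 0) (HC 1).
Definition hand a b := HIf a (HIf b (HC 1) (HC 0)) (HC 0).
Definition himp a b := HIf a b (HC 1).
Definition hle a b := hnot (HSub a b).
Definition hlt a b := hnot (HSub (HAdd a (HC 1)) b).
Definition heq a b := hand (hle a b) (hle b a).
Definition hall x e := hnot (HSum x (hnot e)).
(* The least value of y satisfying e, or the bound if there is none; x is scratch. *)
Definition hfind x y e := HSum x (hall y (himp (hle (HR y) (HR x)) (hnot e))).
(** Multiplication by repeated addition, correct only when [e1] is at most the common bound of all
    sums. *)
Definition hmul x e1 e2 := HSum x (HIf (hlt (HR x) e1) e2 (HC 0)).

(** Bound variables are ordinary registers, so an expression keeps its value under a binder only if
    it does not use that register, not even as a bound variable. *)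
Fixpoint absent (x : nat) (e : hexp) : bool :=
  match e with
  | HC n => true
  | HR y => y != x
  | HRd a e => absent x e
  | HAdd e1 e2 | HSub e1 e2 => absent x e1 && absent x e2
  | HIf e e1 e2 => [&& absent x e, absent x e1 & absent x e2]
  | HSum y e => (y != x) && absent x e
  end.

Lemma heval_eq ar rg rg' e : rg =1 rg' -> heval ar rg e = heval ar rg' e.
Proof.
elim: e rg rg' => //=.
- by move=> a e IH rg rg' E; rewrite (IH _ _ E).
- by move=> e1 IH1 e2 IH2 rg rg' E; rewrite (IH1 _ _ E) (IH2 _ _ E).
- by move=> e1 IH1 e2 IH2 rg rg' E; rewrite (IH1 _ _ E) (IH2 _ _ E).
- by move=> e IH e1 IH1 e2 IH2 rg rg' E; rewrite (IH _ _ E) (IH1 _ _ E) (IH2 _ _ E).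
move=> x e IH rg rg' E; rewrite E; apply: eq_bigr => i _; apply: IH => y.
by rewrite /upd E.
Qed.

(** Register 2 is excluded because every sum reads it without mentioning it. *)
Lemma heval_absent ar rg (x : nat) v e : x != 2 -> absent x e ->
  heval ar (upd rg x v) e = heval ar rg e.
Proof.
move=> nx2; elim: e rg => //=.
- by move=> y rg ny; rewrite upd_neq.
- by move=> a e IH rg /IH->.
- by move=> e1 IH1 e2 IH2 rg /andP[/IH1-> /IH2->].
- by move=> e1 IH1 e2 IH2 rg /andP[/IH1-> /IH2->].
- by move=> e IH e1 IH1 e2 IH2 rg /and3P[/IH-> /IH1-> /IH2->].
move=> y e IH rg /andP[nyx ax]; rewrite upd_neq 1?eq_sym //.
apply: eq_bigr => i _; rewrite -[RHS](IH _ ax); apply: heval_eq => z.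
by rewrite /upd; case: (eqVneq z y) => // ->; rewrite (negbTE nyx).
Qed.

Lemma holds_absent ar rg (x : nat) v e : x != 2 -> absent x e ->
  holds ar (upd rg x v) e = holds ar rg e.
Proof. by move=> nx ax; rewrite /holds heval_absent. Qed.

Lemma heval_if ar rg e e1 e2 : heval ar rg (HIf e e1 e2) =
  if holds ar rg e then heval ar rg e1 else heval ar rg e2.
Proof. by []. Qed.

Lemma heval_rd ar rg a e : heval ar rg (HRd a e) = ar a (heval ar rg e).
Proof. by []. Qed.

Lemma heval_add ar rg e1 e2 : heval ar rg (HAdd e1 e2) = heval ar rg e1 + heval ar rg e2.
Proof. by []. Qed.

Lemma heval_reg ar rg x : heval ar rg (HR x) = rg x.
Proof. by []. Qed.

Lemma heval_sum ar rg x e :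
  heval ar rg (HSum x e) = \sum_(0 <= i < rg 2) heval ar (upd rg x i) e.
Proof. by []. Qed.

Lemma heval_not ar rg e : heval ar rg (hnot e) = ~~ holds ar rg e.
Proof. by rewrite /= /holds; case: eqP. Qed.

Lemma holds_not ar rg e : holds ar rg (hnot e) = ~~ holds ar rg e.
Proof. by rewrite {1}/holds heval_not; case: (holds _ _ _). Qed.

Lemma heval_and ar rg a b : heval ar rg (hand a b) = holds ar rg a && holds ar rg b.
Proof. by rewrite /= /holds; case: eqP => // _; case: eqP. Qed.

Lemma holds_and ar rg a b : holds ar rg (hand a b) = holds ar rg a && holds ar rg b.
Proof. by rewrite {1}/holds heval_and; case: (_ && _). Qed.

Lemma holds_imp ar rg a b : holds ar rg (himp a b) = (holds ar rg a ==> holds ar rg b).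
Proof. by rewrite /holds /=; case: (heval ar rg a == 0). Qed.

Lemma holds_le ar rg a b : holds ar rg (hle a b) = (heval ar rg a <= heval ar rg b).
Proof. by rewrite holds_not /holds /= negbK subn_eq0. Qed.

Lemma holds_lt ar rg a b : holds ar rg (hlt a b) = (heval ar rg a < heval ar rg b).
Proof. by rewrite holds_not /holds /= negbK subn_eq0 addn1. Qed.

Lemma heval_eqE ar rg a b : heval ar rg (heq a b) = (heval ar rg a == heval ar rg b).
Proof. by rewrite heval_and !holds_le eqn_leq. Qed.

Lemma holds_eq ar rg a b : holds ar rg (heq a b) = (heval ar rg a == heval ar rg b).
Proof. by rewrite /holds heval_eqE; case: (heval ar rg a == _). Qed.

Lemma holds_sum ar rg x e : holds ar rg (HSum x e) =
  has (fun i => holds ar (upd rg x i) e) (iota 0 (rg 2)).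
Proof.
rewrite /holds /= sum_nat_seq_eq0 -has_predC /index_iota subn0.
by apply: eq_has => i /=.
Qed.

Lemma holds_all ar rg x e : holds ar rg (hall x e) =
  all (fun i => holds ar (upd rg x i) e) (iota 0 (rg 2)).
Proof.
rewrite holds_not holds_sum -all_predC; apply: eq_all => i /=.
by rewrite holds_not negbK.
Qed.

Definition holdsE := (holds_not, holds_and, holds_imp, holds_le, holds_lt, holds_eq,
  holds_all, holds_sum).

Lemma sum_ltn n f : f <= n -> \sum_(0 <= i < n) (i < f : nat) = f.
Proof.
move=> lef; rewrite -big_mkcond /=.
under eq_bigl do rewrite -[_ < f]andTb.
by rewrite -(big_nat_widen 0 f n predT (fun=> 1) lef) sum_nat_const_nat subn0 muln1.
Qed.

(** The index [i] contributes 1 exactly when no [j <= i] satisfies [P], that is, when [i] lies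
    before the first hit. *)
Lemma find_iota_sum (P : pred nat) n :
  \sum_(0 <= i < n) all (fun j => (j <= i) ==> ~~ P j) (iota 0 n) = find P (iota 0 n).
Proof.
have lef : find P (iota 0 n) <= n by rewrite -{2}(size_iota 0 n) find_size.
rewrite -[RHS](sum_ltn lef); apply: eq_big_nat => i /andP[_ lti]; congr nat_of_bool.
apply/allP/idP => [h|lt j]; last first.
  rewrite mem_iota /= => ltj; apply/implyP => leji.
  have := @before_find _ 0 P (iota 0 n) j (leq_ltn_trans leji lt).
  by rewrite nth_iota // => ->.
rewrite ltnNge; apply/negP => lefi.
have ltf : find P (iota 0 n) < n by apply: leq_ltn_trans lti.
have hasP : has P (iota 0 n) by rewrite has_find size_iota.
have := h (find P (iota 0 n)); rewrite mem_iota /= ltf lefi => /(_ isT) /negP; apply.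
by have := nth_find 0 hasP; rewrite nth_iota.
Qed.

Lemma heval_find ar rg (x y : nat) e : x != 2 -> y != 2 -> x != y -> absent x e ->
  heval ar rg (hfind x y e) = find (fun i => holds ar (upd rg y i) e) (iota 0 (rg 2)).
Proof.
move=> nx ny nxy ax; rewrite -find_iota_sum /=.
apply: eq_bigr => i _.
rewrite -[LHS]/(heval ar (upd rg x i) (hall y (himp (hle (HR y) (HR x)) (hnot e)))).
rewrite heval_not -holds_not -/(hall y _) holds_all upd_neq 1?eq_sym //.
congr nat_of_bool; apply: eq_all => j; rewrite !holdsE /= upd_id upd_neq // upd_id.
congr (_ ==> ~~ _); rewrite -[RHS](@holds_absent _ _ x i) //.
rewrite /holds; congr (_ != 0); apply: heval_eq => z.
by rewrite /upd; case: (eqVneq z x) => // ->; rewrite (negbTE nxy).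
Qed.

Lemma find_iotaP (P : pred nat) n : let f := find P (iota 0 n) in
  [/\ (f < n) = has P (iota 0 n), f < n -> P f & ~~ (f < n) -> forall i, i < n -> ~~ P i].
Proof.
have E : (find P (iota 0 n) < n) = has P (iota 0 n) by rewrite has_find size_iota.
split=> //= [ltf|].
  by have := nth_find 0 (etrans (esym E) ltf); rewrite nth_iota.
by rewrite E => /hasPn h i lti; apply: h; rewrite mem_iota.
Qed.

Lemma heval_mul ar rg (x : nat) e1 e2 : x != 2 -> absent x e1 -> absent x e2 ->
  heval ar rg e1 <= rg 2 ->
  heval ar rg (hmul x e1 e2) = heval ar rg e1 * heval ar rg e2.
Proof.
move=> nx a1 a2 le1; rewrite -(sum_ltn le1) big_distrl.
transitivity (\sum_(0 <= i < rg 2) heval ar (upd rg x i) (HIf (hlt (HR x) e1) e2 (HC 0))).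
  by [].
apply: eq_bigr => i _; rewrite heval_if holds_lt [heval _ _ (HR x)]upd_id !heval_absent //.
by case: (i < _) => /=; rewrite ?mul1n ?mul0n.
Qed.

(** * Frame properties and the loop rule *)

Fixpoint wregs (c : hcmd) : seq nat :=
  match c with
  | HAsg x _ => [:: x]
  | HWr _ _ _ | HSkip => [::]
  | HSeq c1 c2 | HCond _ c1 c2 => wregs c1 ++ wregs c2
  | HFor x c => x :: wregs c
  end.

Fixpoint warrs (c : hcmd) : seq nat :=
  match c with
  | HWr a _ _ => [:: a]
  | HAsg _ _ | HSkip => [::]
  | HSeq c1 c2 | HCond _ c1 c2 => warrs c1 ++ warrs c2
  | HFor x c => warrs c
  end.

Lemma hsem_regs c s x : x \notin wregs c -> regs (hsem c s) x = regs s x.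
Proof.
elim: c s => //=.
- by move=> y e s; rewrite inE => nx; rewrite upd_neq.
- by move=> c1 IH1 c2 IH2 s; rewrite mem_cat => /norP[n1 n2]; rewrite IH2 ?IH1.
- by move=> e c1 IH1 c2 IH2 s; rewrite mem_cat => /norP[n1 n2]; case: ifP; rewrite ?IH2 ?IH1.
move=> y c IH s; rewrite inE => /norP[nxy nc].
by elim: {1}(regs s 2) => //= n IHn; rewrite IH //= upd_neq.
Qed.

Lemma hsem_arrs c s a : a \notin warrs c -> arrs (hsem c s) a = arrs s a.
Proof.
elim: c s => //=.
- by move=> b e1 e2 s; rewrite inE => nx; rewrite upd_neq.
- by move=> c1 IH1 c2 IH2 s; rewrite mem_cat => /norP[n1 n2]; rewrite IH2 ?IH1.
- by move=> e c1 IH1 c2 IH2 s; rewrite mem_cat => /norP[n1 n2]; case: ifP; rewrite ?IH2 ?IH1.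
move=> y c IH s nc.
by elim: {1}(regs s 2) => //= n IHn; rewrite IH.
Qed.

Lemma hsem_for x c s (P : nat -> state -> Prop) : P 0 s ->
  (forall i s', i < regs s 2 -> P i s' -> P i.+1 (hsem c (set_reg s' x i))) ->
  P (regs s 2) (hsem (HFor x c) s).
Proof.
move=> P0 PS /=; elim: {-2}(regs s 2) (leqnn (regs s 2)) => //= n IH le.
by apply: PS => //; apply: IH; apply: ltnW.
Qed.

(** * The decision program *)

(* Registers 0-2: k, l, k * l; 3: the answer; 4: the number of candidates; 5-7: the
   guesses (orientation, threshold, column); 8, 9: the oriented dimensions; 10, 11:
   whether the row and column weights are 2; 12: loop counter; 13, 14: the label that
   bids; 15: the column it takes; 16, 17: loop counters; 18, 19: positions of
   candidates; 20 and above: bound variables.  Arrays 1, 2: row labels; 3: prices;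
   4, 5: owners. *)

(** The transposed matrix is never stored: a nonzero register 5 only swaps the indices, while the
    stride remains l. *)
Definition hcell i j :=
  HRd 0 (HIf (HR 5) (HAdd (hmul 20 j (HR 1)) i) (HAdd (hmul 20 i (HR 1)) j)).

Definition hvec f b c v := HAdd (heq v b) (hand f (heq v c)).

(** Names of candidates are arbitrary numbers, so candidates are quantified over through the cells
    of the matrix: each of them occupies some cell. *)
Definition happroves x1 x2 b c w :=
  hall 21 (hle (HAdd (hvec (HR 10) x1 x2 (HRd 0 (HR 21))) (hvec (HR 11) b c (HRd 0 (HR 21))))
               (HAdd (hvec (HR 10) x1 x2 w) (hvec (HR 11) b c w))).

Definition hadj j b c :=
  hand (hlt j (HR 9))
    (hall 22 (himp (hlt (HR 22) (HR 8))
       (happroves (HRd 1 (HR 22)) (HRd 2 (HR 22)) b c (hcell (HR 22) j)))).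

Definition hheavy i v :=
  hle (HR 6) (HSum 23 (HIf (hand (hlt (HR 23) (HR 9)) (heq (hcell i (HR 23)) v))
                           (HC 1) (HC 0))).

(** Position of a least heavy candidate of the row or, with the order reversed, of a greatest one;
    these are the two components of the label. The result is the bound if nothing is heavy. *)
Definition hextreme (le : hexp -> hexp -> hexp) :=
  hfind 24 25 (hand (hheavy (HR 12) (HRd 0 (HR 25)))
    (hall 26 (himp (hheavy (HR 12) (HRd 0 (HR 26))) (le (HRd 0 (HR 25)) (HRd 0 (HR 26)))))).

Definition row_cmd a le :=
  HSeq (HAsg 18 (hextreme le))
    (HWr a (HR 12) (HIf (hlt (HR 18) (HR 2)) (HRd 0 (HR 18)) (hcell (HR 12) (HR 7)))).

Definition hlabel f b c := HIf f (hle b c) (heq b c).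

Definition hunassigned b c :=
  hall 27 (himp (hand (hlt (HR 27) (HR 9)) (hlt (HC 0) (HRd 3 (HR 27))))
                (hnot (hand (heq (HRd 4 (HR 27)) b) (heq (HRd 5 (HR 27)) c)))).

Definition hbidder n m :=
  hand (hlabel (HR 11) (HRd 0 n) (HRd 0 m)) (hunassigned (HRd 0 n) (HRd 0 m)).

Definition hbest :=
  hand (hadj (HR 29) (HR 13) (HR 14)) (hand (hle (HRd 3 (HR 29)) (HR 9))
    (hall 30 (himp (hadj (HR 30) (HR 13) (HR 14)) (hle (HRd 3 (HR 29)) (HRd 3 (HR 30)))))).

Definition buy_cmd :=
  HCond (hlt (HR 15) (HR 2))
    (HSeq (HWr 4 (HR 15) (HR 13)) (HSeq (HWr 5 (HR 15) (HR 14))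
      (HWr 3 (HR 15) (HAdd (HRd 3 (HR 15)) (HC 1)))))
    HSkip.

Definition bid_cmd :=
  HSeq (HAsg 18 (hfind 28 29 (HSum 30 (hbidder (HR 29) (HR 30)))))
    (HCond (hlt (HR 18) (HR 2))
      (HSeq (HAsg 19 (hfind 28 29 (hbidder (HR 18) (HR 29))))
      (HSeq (HAsg 13 (HRd 0 (HR 18))) (HSeq (HAsg 14 (HRd 0 (HR 19)))
      (HSeq (HAsg 15 (hfind 28 29 hbest)) buy_cmd))))
      HSkip).

(** Distinct row labels are enough: as there are as many rows as labels, every label is then
    used. *)
Definition hvalid :=
  hall 31 (himp (hlt (HR 31) (HR 8))
    (hand (hand (HSum 32 (heq (HRd 0 (HR 32)) (HRd 1 (HR 31))))
                (HSum 32 (heq (HRd 0 (HR 32)) (HRd 2 (HR 31)))))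
    (hand (hlabel (HR 10) (HRd 1 (HR 31)) (HRd 2 (HR 31)))
       (hall 33 (himp (hand (hlt (HR 33) (HR 8)) (hand (heq (HRd 1 (HR 31)) (HRd 1 (HR 33)))
                                                   (heq (HRd 2 (HR 31)) (HRd 2 (HR 33)))))
                      (heq (HR 31) (HR 33))))))).

Definition hdone := hall 29 (hall 30 (hnot (hbidder (HR 29) (HR 30)))).

(** Owners left over from the previous guess need no reset, since a column of price 0 counts as
    unowned. The flag in register 3 is raised only after both final tests and is never lowered. *)
Definition guess_cmd :=
  HSeq (HAsg 8 (HIf (HR 5) (HR 1) (HR 0)))
 (HSeq (HAsg 9 (HIf (HR 5) (HR 0) (HR 1)))
 (HSeq (HAsg 10 (hnot (heq (HR 8) (HR 4))))
 (HSeq (HAsg 11 (hnot (heq (HR 9) (HR 4))))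
 (HSeq (HFor 12 (HSeq (row_cmd 1 hle) (row_cmd 2 (fun a b => hle b a))))
 (HSeq (HFor 12 (HWr 3 (HR 12) (HC 0)))
 (HSeq (HFor 16 (HFor 17 bid_cmd))
       (HCond (hand hvalid hdone) (HAsg 3 (HC 1)) HSkip))))))).

(** Register 4 receives p as the number of cells whose value does not recur later. All orientations
    other than 0 act alike. *)
Definition main_cmd :=
  HSeq (HAsg 4 (HSum 20 (hall 21 (himp (hlt (HR 20) (HR 21))
                                       (hnot (heq (HRd 0 (HR 21)) (HRd 0 (HR 20))))))))
 (HSeq (HFor 5 (HFor 6 (HFor 7 guess_cmd))) (HAsg 0 (HR 3))).

Lemma absent_le x a b : absent x (hle a b) = absent x a && absent x b.
Proof. by rewrite /= andbT. Qed.

(** Needed for candidates under both orders and for columns compared by price, where distinct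
    elements may tie. *)
Lemma has_extreme (T : eqType) (R : rel T) (P : pred T) (s : seq T) :
  total R -> transitive R -> has P s ->
  exists v, [/\ v \in s, P v & {in s, forall w, P w -> R v w}].
Proof.
move=> totR trR; have reflR x : R x x by have := totR x x; rewrite orbb.
elim: s => //= x s IH; case: (boolP (has P s)) => [/IH[v [vs Pv mv]] _|nh].
  case: (boolP (P x && R x v)) => [/andP[Px Rxv]|nx].
    exists x; split=> //; first by rewrite inE eqxx.
    move=> w; rewrite inE => /orP[/eqP->//|ws Pw]; apply: trR Rxv _; exact: mv.
  exists v; split=> //; first by rewrite inE vs orbT.
  move=> w; rewrite inE => /orP[/eqP-> Px|ws Pw]; last exact: mv.
  by have := totR v x; rewrite Px /= in nx; rewrite (negbTE nx) orbF.
rewrite orbF => Px; exists x; split=> //; first by rewrite inE eqxx.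
move=> w; rewrite inE => /orP[/eqP->//|ws Pw].
by case/hasP: nh; exists w.
Qed.

(** * Correctness of a single guess *)

Section Guess.
Variables (k l : nat) (g : 'M[nat]_(k, l)) (al be tr th j0 : nat).
Let N := k * l.
Let ent := entries g.
Let K := if tr != 0 then l else k.
Let L := if tr != 0 then k else l.
Let H i j := if tr != 0 then cell g j i else cell g i j.
Hypotheses (k0 : 0 < k) (l0 : 0 < l).
Hypotheses (al2 : 0 < al <= 2) (be2 : 0 < be <= 2).
Hypotheses (EK : K = size (labels ent al)) (EL : L = size (labels ent be)).
Hypothesis (j0N : j0 < N).

(** What stays fixed from the labelling of the rows to the final tests; of registers 10 and 11 only
    being nonzero matters. *)
Record ctx (ar : nat -> nat -> nat) (rg : nat -> nat) : Prop := Ctx {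
  ctx_ar : ar 0 =1 nth 0 (row_major g);
  ctx1 : rg 1 = l; ctx2 : rg 2 = N; ctx5 : rg 5 = tr; ctx6 : rg 6 = th; ctx7 : rg 7 = j0;
  ctx8 : rg 8 = K; ctx9 : rg 9 = L;
  ctx10 : (rg 10 != 0) = (al == 2); ctx11 : (rg 11 != 0) = (be == 2) }.

Lemma ctx_upd ar rg x v : 11 < x -> ctx ar rg -> ctx ar (upd rg x v).
Proof. by move=> gt [? ? ? ? ? ? ? ? ? ?]; split; rewrite ?upd_neq //; lia. Qed.

Lemma ctx_hsem c s : (forall x, x < 12 -> x \notin wregs c) -> 0 \notin warrs c ->
  ctx (arrs s) (regs s) -> ctx (arrs (hsem c s)) (regs (hsem c s)).
Proof.
move=> nr na [? ? ? ? ? ? ? ? ? ?].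
by split; rewrite ?hsem_regs ?hsem_arrs //; apply: nr.
Qed.

Lemma leKN : K <= N. Proof. rewrite /K /N; case: ifP => _; nia. Qed.
Lemma leLN : L <= N. Proof. rewrite /L /N; case: ifP => _; nia. Qed.

Lemma all_cells (P : pred nat) : all (fun n => P (nth 0 (row_major g) n)) (iota 0 N) = all P ent.
Proof.
rewrite -(all_map (nth 0 (row_major g)) P) -/(mkseq _ _) /N -(size_row_major g) mkseq_nth.
by apply: eq_all_r => x; rewrite mem_undup.
Qed.

Lemma has_cells (P : pred nat) : has (fun n => P (nth 0 (row_major g) n)) (iota 0 N) = has P ent.
Proof.
rewrite -(has_map (nth 0 (row_major g)) P) -/(mkseq _ _) /N -(size_row_major g) mkseq_nth.
by apply: eq_has_r => x; rewrite mem_undup.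
Qed.

Lemma heval_cell ar rg i j : ctx ar rg -> absent 20 i -> absent 20 j ->
  heval ar rg i <= N -> heval ar rg j <= N ->
  heval ar rg (hcell i j) = H (heval ar rg i) (heval ar rg j).
Proof.
move=> C ai aj lei lej; rewrite heval_rd (ctx_ar C) heval_if /holds heval_reg (ctx5 C) /H /cell.
have C2 := ctx2 C; have C1 := ctx1 C.
by case: ifP => _; rewrite heval_add heval_mul ?C2 //= C1.
Qed.

Lemma heval_vec ar rg (w : nat) f b c v : holds ar rg f = (w == 2) ->
  heval ar rg (hvec f b c v) = vec w (heval ar rg b, heval ar rg c) (heval ar rg v).
Proof.
move=> Ef; by rewrite heval_add heval_eqE heval_and holds_eq Ef.
Qed.

Lemma holds_approves ar rg x1 x2 b c w : ctx ar rg ->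
  [&& absent 21 x1, absent 21 x2, absent 21 b, absent 21 c & absent 21 w] ->
  holds ar rg (happroves x1 x2 b c w) =
  approves ent al be (heval ar rg x1, heval ar rg x2) (heval ar rg b, heval ar rg c)
    (heval ar rg w).
Proof.
move=> C /and5P[a1 a2 ab ac aw].
rewrite holds_all (ctx2 C) /approves -all_cells; apply: eq_all => n.
have Cn := @ctx_upd _ _ 21 n isT C.
have f10 : holds ar (upd rg 21 n) (HR 10) = (al == 2) by rewrite -(ctx10 Cn).
have f11 : holds ar (upd rg 21 n) (HR 11) = (be == 2) by rewrite -(ctx11 Cn).
rewrite holds_le ![heval _ _ (HAdd (hvec _ _ _ _) _)]heval_add.
rewrite !(heval_vec _ _ _ f10) !(heval_vec _ _ _ f11).
by rewrite heval_rd heval_reg upd_id (ctx_ar C) !heval_absent.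
Qed.

Definition adj (s : nat -> nat * nat) (u : nat * nat) (j : nat) : bool :=
  (j < L) && all (fun i => (i < K) ==> approves ent al be (s i) u (H i j)) (iota 0 N).

Lemma holds_adj ar rg j b c : ctx ar rg ->
  [&& absent 20 j, absent 21 j & absent 22 j] -> absent 21 b -> absent 22 b ->
  absent 21 c -> absent 22 c ->
  holds ar rg (hadj j b c) =
  adj (fun i => (ar 1 i, ar 2 i)) (heval ar rg b, heval ar rg c) (heval ar rg j).
Proof.
move=> C /and3P[aj0 aj1 aj2] ab1 ab2 ac1 ac2.
rewrite holds_and holds_lt heval_reg (ctx9 C) /adj.
case: (ltnP (heval ar rg j) L) => //= ltj; rewrite holds_all (ctx2 C).
apply: eq_in_all => i; rewrite mem_iota /= => lti.
have Ci := @ctx_upd _ _ 22 i isT C.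
rewrite holds_imp holds_lt !heval_reg (ctx8 Ci) upd_id.
case: ltnP => //= ltiK; rewrite holds_approves //; last first.
  by rewrite ab1 ac1 /= aj1.
rewrite heval_cell //; last 2 first.
- exact: ltnW.
- by rewrite heval_absent //; apply: ltnW; apply: leq_trans leLN.
by rewrite !heval_rd !heval_reg upd_id !heval_absent.
Qed.

Lemma holds_heavy ar rg i v : ctx ar rg -> absent 20 i -> absent 23 i -> absent 23 v ->
  heval ar rg i <= N ->
  holds ar rg (hheavy i v) = (th <= occ L H (heval ar rg i) (heval ar rg v)).
Proof.
move=> C ai0 ai av lei; rewrite holds_le heval_reg (ctx6 C); congr (_ <= _).
rewrite heval_sum (ctx2 C).
transitivity (\sum_(0 <= j < N | j < L) (H (heval ar rg i) j == heval ar rg v : nat)).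
  rewrite [RHS]big_mkcond; apply: eq_big_nat => j /andP[_ ltj].
  have Cj := @ctx_upd _ _ 23 j isT C.
  rewrite heval_if holds_and holds_lt holds_eq !heval_reg (ctx9 Cj).
  rewrite upd_id heval_cell //; last 2 first.
  - by rewrite heval_absent.
  - by rewrite /= upd_id ltnW.
  rewrite heval_reg upd_id !heval_absent //.
  by case: (j < L) => //=; case: (_ == _).
rewrite (eq_bigl (fun j => true && (j < L))) //.
rewrite -(big_nat_widen 0 L N predT (fun j => (H (heval ar rg i) j == heval ar rg v : nat)) leLN).
by rewrite /occ -sum1_count [RHS]big_mkcond /index_iota subn0; apply: eq_bigr => j _; case: eqP.
Qed.

Lemma all_guard (P : pred nat) M : M <= N ->
  all (fun i => (i < M) ==> P i) (iota 0 N) = all P (iota 0 M).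
Proof.
move=> leM; apply/allP/allP => h i; rewrite mem_iota /= => lti.
  by have := h i; rewrite mem_iota /= lti (leq_trans lti leM); apply.
by apply/implyP => ltiM; apply: h; rewrite mem_iota.
Qed.

Definition heavy i v := th <= occ L H i v.

Definition extreme (R : rel nat) i v :=
  (has (heavy i) ent -> [/\ v \in ent, heavy i v & {in ent, forall w, heavy i w -> R v w}])
  /\ (~~ has (heavy i) ent -> v = H i j0).

Lemma row_guess_extreme i b c :
  extreme leq i b -> extreme geq i c -> row_guess ent th j0 L H i (b, c).
Proof.
move=> [b1 b2] [c1 c2]; split=> [[v vE hv]|nh].
  have h : has (heavy i) ent by apply/hasP; exists v.
  have [bE hb bm] := b1 h; have [cE hc cm] := c1 h; split=> // w wE hw /=.
  by rewrite bm //; exact: cm.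
have h : ~~ has (heavy i) ent by apply/hasP => -[v vE hv]; apply: nh; exists v.
by rewrite b2 // c2.
Qed.

Lemma heval_extreme (le : hexp -> hexp -> hexp) (R : rel nat) ar rg :
  total R -> transitive R ->
  (forall ar rg a b, holds ar rg (le a b) = R (heval ar rg a) (heval ar rg b)) ->
  (forall x a b, absent x (le a b) = absent x a && absent x b) ->
  ctx ar rg -> rg 12 < N ->
  let f := heval ar rg (hextreme le) in
  extreme R (rg 12) (if f < N then nth 0 (row_major g) f else H (rg 12) j0).
Proof.
move=> totR trR hR aR C lti f.
pose Q v := heavy (rg 12) v && all (fun w => heavy (rg 12) w ==> R v w) ent.
have fE : f = find (fun n => Q (nth 0 (row_major g) n)) (iota 0 N).
  rewrite /f heval_find //; last by rewrite /= aR.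
  rewrite (ctx2 C); apply: eq_in_find => n _.
  have Cn := @ctx_upd _ _ 25 n isT C.
  rewrite holds_and holds_heavy //; last by rewrite heval_reg upd_neq // ltnW.
  rewrite heval_rd !heval_reg upd_id upd_neq // (ctx_ar C); congr (_ && _).
  rewrite holds_all (ctx2 Cn) -all_cells; apply: eq_all => m.
  have Cm := @ctx_upd _ _ 26 m isT Cn.
  rewrite holds_imp holds_heavy //; last by rewrite heval_reg !upd_neq // ltnW.
  rewrite hR !heval_rd !heval_reg upd_id (@upd_neq _ _ 26 m 12) //.
  by rewrite (@upd_neq _ _ 26 m 25) // upd_id upd_neq // !(ctx_ar C).
have := find_iotaP (fun n => Q (nth 0 (row_major g) n)) N; rewrite -fE /= => -[lt_f Qf nQ].
split=> [h|nh]; last first.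
  rewrite lt_f has_cells; case: hasP => // -[v vE /andP[hv _]].
  by case/hasP: nh; exists v.
have ltf : f < N.
  rewrite lt_f has_cells; have [v [vE Pv mv]] := has_extreme totR trR h.
  apply/hasP; exists v; rewrite // /Q Pv; apply/allP => w wE; apply/implyP; exact: mv.
rewrite ltf; have /andP[hv /allP mv] := Qf ltf; split=> // [|w wE]; last exact/implyP/mv.
by rewrite mem_undup mem_nth // size_row_major.
Qed.

Lemma row_cmdP (le : hexp -> hexp -> hexp) (R : rel nat) a s :
  total R -> transitive R ->
  (forall ar rg a b, holds ar rg (le a b) = R (heval ar rg a) (heval ar rg b)) ->
  (forall x a b, absent x (le a b) = absent x a && absent x b) ->
  ctx (arrs s) (regs s) -> regs s 12 < N ->
  exists2 v, extreme R (regs s 12) v &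
    exists f, hsem (row_cmd a le) s = set_cell (set_reg s 18 f) a (regs s 12) v.
Proof.
move=> totR trR hR aR C lti; pose f := heval (arrs s) (regs s) (hextreme le).
have ex : extreme R (regs s 12) (if f < N then nth 0 (row_major g) f else H (regs s 12) j0).
  exact: heval_extreme.
exists (if f < N then nth 0 (row_major g) f else H (regs s 12) j0); first exact: ex.
exists f; have C' := @ctx_upd _ _ 18 f isT C.
rewrite -[LHS]/(set_cell (set_reg s 18 f) a (regs (set_reg s 18 f) 12)
  (heval (arrs s) (upd (regs s) 18 f)
    (HIf (hlt (HR 18) (HR 2)) (HRd 0 (HR 18)) (hcell (HR 12) (HR 7))))).
congr set_cell; rewrite heval_if holds_lt !heval_reg (ctx2 C') upd_id.
rewrite heval_rd (ctx_ar C) heval_reg upd_id heval_cell //.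
- by rewrite !heval_reg (ctx7 C').
- by rewrite heval_reg upd_neq // ltnW.
- by rewrite heval_reg (ctx7 C') ltnW.
Qed.

Definition row_labels s i := (arrs s 1 i, arrs s 2 i).

Definition rows_cmd := HFor 12 (HSeq (row_cmd 1 hle) (row_cmd 2 (fun a b => hle b a))).

(** The loop also labels indices from [K] up to [N]; this is harmless, as [H] is total and only the
    first [K] labels are used. *)
Lemma rows_cmdP s : ctx (arrs s) (regs s) ->
  forall i, i < N -> row_guess ent th j0 L H i (row_labels (hsem rows_cmd s) i).
Proof.
move=> C; pose P i s' := ctx (arrs s') (regs s') /\
  forall i', i' < i -> row_guess ent th j0 L H i' (row_labels s' i').
suff : P (regs s 2) (hsem rows_cmd s) by rewrite (ctx2 C) => -[].
apply: hsem_for => // i s'; rewrite (ctx2 C) => lti [C' ok].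
have C1 := @ctx_upd _ _ 12 i isT C'.
have [//|b exb [f1 E1]] := @row_cmdP hle leq 1 (set_reg s' 12 i) leq_total leq_trans holds_le
  absent_le C1.
set s1 := set_cell _ _ _ _ in E1.
have C2 : ctx (arrs s1) (regs s1).
  by rewrite -E1; apply: ctx_hsem => // x; do 12?[case: x => [|x] //].
have totG : total geq by move=> x y; apply: leq_total.
have trG : transitive geq by move=> x y z h1 h2; apply: leq_trans h2 h1.
have [||||c exc [f2 E2]] := @row_cmdP (fun a b => hle b a) geq 2 s1 totG trG.
- by move=> *; apply: holds_le.
- by move=> *; rewrite absent_le andbC.
- by [].
- by [].
have s2E : hsem (HSeq (row_cmd 1 hle) (row_cmd 2 (fun a b => hle b a))) (set_reg s' 12 i)
    = set_cell (set_reg s1 18 f2) 2 (regs s1 12) c by rewrite -E2 -E1.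
rewrite s2E; split.
  by rewrite -E2; apply: ctx_hsem => // x; do 12?[case: x => [|x] //].
move=> i'; rewrite ltnS leq_eqVlt => /orP[/eqP->|lti'].
  by rewrite /row_labels /= /upd /= !eqxx; apply: row_guess_extreme.
have := ok i' lti'; rewrite /row_labels /= /upd /=.
by rewrite (_ : (i' == i) = false) //; apply/negbTE; rewrite neq_ltn lti'.
Qed.

Definition owners s j := (arrs s 4 j, arrs s 5 j).

Lemma holds_label ar rg (w : nat) f b c : holds ar rg f = (w == 2) ->
  holds ar rg (hlabel f b c) =
  if w == 2 then heval ar rg b <= heval ar rg c else heval ar rg b == heval ar rg c.
Proof.
move=> Ef; rewrite /holds heval_if Ef.
by case: ifP => _; rewrite -/(holds _ _ _) ?holds_le ?holds_eq.
Qed.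

Lemma holds_unassigned ar rg b c : ctx ar rg -> absent 27 b -> absent 27 c ->
  holds ar rg (hunassigned b c) =
  ~~ assigned L (ar 3) (fun j => (ar 4 j, ar 5 j)) (heval ar rg b, heval ar rg c).
Proof.
move=> C ab ac; rewrite /assigned -all_predC -(all_guard _ leLN) holds_all (ctx2 C).
apply: eq_all => j; have Cj := @ctx_upd _ _ 27 j isT C.
rewrite holds_imp holds_not 2!holds_and !holds_lt !holds_eq !heval_rd !heval_reg (ctx9 Cj).
rewrite upd_id !heval_absent //= xpair_eqE.
by case: (j < L); case: (0 < _).
Qed.

Let A n := nth 0 (row_major g) n.

Definition bidder (pr : nat -> nat) ow n m : bool :=
  ((A n, A m) \in labels ent be) && ~~ assigned L pr ow (A n, A m).

Lemma A_mem n : n < N -> A n \in ent.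
Proof. by move=> ltn; rewrite mem_undup mem_nth // size_row_major. Qed.

Lemma A_onto v : v \in ent -> exists2 n, n < N & A n = v.
Proof.
rewrite mem_undup => vE; exists (index v (row_major g)); last exact: nth_index.
by rewrite /N -(size_row_major g) index_mem.
Qed.

Lemma holds_bidder ar rg n m : ctx ar rg -> absent 27 n -> absent 27 m ->
  heval ar rg n < N -> heval ar rg m < N ->
  holds ar rg (hbidder n m) =
  bidder (ar 3) (fun j => (ar 4 j, ar 5 j)) (heval ar rg n) (heval ar rg m).
Proof.
move=> C an am ltn ltm; rewrite holds_and holds_unassigned // /bidder mem_labels /=.
rewrite (holds_label _ _ (w := be)); last by rewrite -(ctx11 C).
by rewrite !heval_rd !(ctx_ar C) !A_mem.
Qed.

Lemma hsem_seq c1 c2 s : hsem (HSeq c1 c2) s = hsem c2 (hsem c1 s).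
Proof. by []. Qed.

Lemma hsem_asg x e s v : heval (arrs s) (regs s) e = v -> hsem (HAsg x e) s = set_reg s x v.
Proof. by move=> <-. Qed.

Lemma hsem_cond e c1 c2 s :
  hsem (HCond e c1 c2) s = if holds (arrs s) (regs s) e then hsem c1 s else hsem c2 s.
Proof. by []. Qed.

Lemma bid_cmdP s : ctx (arrs s) (regs s) ->
  auction_step (labels ent be) L (adj (row_labels s)) (arrs s 3) (owners s)
    (arrs (hsem bid_cmd s) 3) (owners (hsem bid_cmd s)).
Proof.
move=> C; pose U := bidder (arrs s 3) (owners s).
pose f1 := find (fun n => has (U n) (iota 0 N)) (iota 0 N).
rewrite /bid_cmd hsem_seq (hsem_asg _ (v := f1)); last first.
  rewrite heval_find // (ctx2 C); apply: eq_in_find => n; rewrite mem_iota /= => ltn.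
  have Cn := @ctx_upd _ _ 29 n isT C.
  rewrite holds_sum (ctx2 Cn); apply: eq_in_has => m; rewrite mem_iota /= => ltm.
  have Cm := @ctx_upd _ _ 30 m isT Cn.
  by rewrite holds_bidder // !heval_reg ?upd_id // upd_neq // upd_id.
set s1 := set_reg s 18 f1; have C1 : ctx (arrs s1) (regs s1) by apply: ctx_upd.
have [f1E U1 nU1] := find_iotaP (fun n => has (U n) (iota 0 N)) N.
rewrite -/f1 in f1E U1 nU1.
rewrite hsem_cond holds_lt !heval_reg (ctx2 C1) [regs s1 18]upd_id.
case: ifP => ltf1; last first.
  (* The search for a bidder failed, so every label is assigned. *)
  right; split=> //; left => -[b c] uL; move: (uL); rewrite mem_labels /= => /and3P[bE cE _].
  have [n ltn An] := A_onto bE; have [m ltm Am] := A_onto cE.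
  have /hasPn/(_ m) := nU1 (negbT ltf1) n ltn.
  by rewrite mem_iota /= /U /bidder An Am uL /= negbK; apply.
have {nU1 U1}/hasP[m0 m0N Um0] := U1 ltf1.
pose f2 := find (U f1) (iota 0 N).
have [f2E U2 _] := find_iotaP (U f1) N; rewrite -/f2 in f2E U2.
have ltf2 : f2 < N by rewrite f2E; apply/hasP; exists m0.
have {U2 f2E f1E m0N Um0}/andP[uL nu] := U2 ltf2.
rewrite hsem_seq (hsem_asg _ (v := f2)); last first.
  rewrite heval_find // (ctx2 C1); apply: eq_in_find => m; rewrite mem_iota /= => ltm.
  have Cm := @ctx_upd _ _ 29 m isT C1.
  have r18 : upd (regs s1) 29 m 18 = f1 by [].
  by rewrite holds_bidder // !heval_reg ?r18 ?upd_id.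
set s2 := set_reg s1 19 f2; have C2 : ctx (arrs s2) (regs s2) by apply: ctx_upd.
rewrite hsem_seq (hsem_asg _ (v := A f1)); last first.
  by rewrite heval_rd (ctx_ar C2) heval_reg.
set s3 := set_reg s2 13 (A f1); have C3 : ctx (arrs s3) (regs s3) by apply: ctx_upd.
rewrite hsem_seq (hsem_asg _ (v := A f2)); last first.
  by rewrite heval_rd (ctx_ar C3) heval_reg.
set s4 := set_reg s3 14 (A f2); have C4 : ctx (arrs s4) (regs s4) by apply: ctx_upd.
set u := (A f1, A f2) in uL nu.
pose best j := [&& adj (row_labels s) u j, arrs s 3 j <= L &
  all (fun j' => adj (row_labels s) u j' ==> (arrs s 3 j <= arrs s 3 j')) (iota 0 N)].
pose f3 := find best (iota 0 N).
rewrite hsem_seq (hsem_asg _ (v := f3)); last first.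
  rewrite heval_find // (ctx2 C4); apply: eq_in_find => j; rewrite mem_iota /= => ltj.
  have Cj := @ctx_upd _ _ 29 j isT C4.
  rewrite 2!holds_and holds_adj // holds_le !heval_rd !heval_reg upd_id (ctx9 Cj).
  congr [&& _, _ & _]; rewrite holds_all (ctx2 Cj); apply: eq_all => j'.
  have Cj' := @ctx_upd _ _ 30 j' isT Cj.
  by rewrite holds_imp holds_adj // holds_le.
set s5 := set_reg s4 15 f3; have C5 : ctx (arrs s5) (regs s5) by apply: ctx_upd.
have [f3E B3 nB3] := find_iotaP best N; rewrite -/f3 in f3E B3 nB3.
rewrite /buy_cmd hsem_cond holds_lt !heval_reg (ctx2 C5) [regs s5 15]upd_id.
case: ifP => ltf3; last first.
  (* If the bidder wanted some affordable column, the cheapest wanted one would be affordable as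
     well and the search would have found it. *)
  right; split=> //; right; exists u; split=> // j auj; rewrite ltnNge; apply/negP => lej.
  have [v [_ Pv mv]] : exists v, [/\ v \in iota 0 N, adj (row_labels s) u v &
      {in iota 0 N, forall w, adj (row_labels s) u w -> arrs s 3 v <= arrs s 3 w}].
    apply: (@has_extreme _ (fun a b => arrs s 3 a <= arrs s 3 b)).
    - by move=> a b; apply: leq_total.
    - by move=> a b c; apply: leq_trans.
    - apply/hasP; exists j => //; rewrite mem_iota /=.
      by case/andP: auj => ltj _; apply: leq_trans leLN.
  have jN : j \in iota 0 N.
    by rewrite mem_iota /=; case/andP: auj => ltj _; apply: leq_trans leLN.
  have vN : v < N by case/andP: Pv => ltv _; apply: leq_trans leLN.
  have /negP := nB3 (negbT ltf3) v vN; apply; rewrite /best Pv /=.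
  rewrite (leq_trans (mv j jN auj) lej) /=; apply/allP => w wN; apply/implyP; exact: mv.
left; exists u, f3; have /and3P[auj lej /allP mj] := B3 ltf3.
split=> //; split=> [j' auj'|j'|j'].
- have j'N : j' \in iota 0 N.
    by rewrite mem_iota /=; case/andP: auj' => ltj _; apply: leq_trans leLN.
  exact: (implyP (mj _ j'N)).
- by rewrite /= /upd /=; case: ifP => // _; rewrite addn1.
- by rewrite /owners /= /upd /=; case: ifP.
Qed.

Hypothesis p3 : 3 <= size ent.

Let ent_uniq : uniq ent. Proof. exact: undup_uniq. Qed.

Definition auction_cmd := HFor 16 (HFor 17 bid_cmd).

Definition matchable S : Prop := exists2 m : nat * nat -> nat,
  {in labels ent be, forall v, adj S v (m v)} & {in labels ent be &, injective m}.

Definition auction_good S n s : Prop :=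
  [/\ ctx (arrs s) (regs s), row_labels s = S,
      auction_inv (labels ent be) L (adj S) (arrs s 3) (owners s) &
      matchable S -> {in labels ent be, forall u, assigned L (arrs s 3) (owners s) u} \/
                     n <= \sum_(i < L) arrs s 3 i].

Lemma adj_lt S u j : adj S u j -> j < L.
Proof. by case/andP. Qed.

Lemma auction_good_bid S n s : auction_good S n s -> auction_good S n.+1 (hsem bid_cmd s).
Proof.
case=> C ES I M; have step := bid_cmdP C; rewrite ES in step.
split.
- by apply: ctx_hsem => // x; do 12?[case: x => [|x] //].
- by rewrite -ES /row_labels !hsem_arrs.
- exact: auction_step_inv step I.
move=> mS; have [m am im] := mS.
exact: (auction_step_progress (labels_uniq be ent_uniq) (@adj_lt S) am im I step (M mS)).
Qed.

Lemma auction_good_set S n s x v : 11 < x -> auction_good S n s -> auction_good S n (set_reg s x v).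
Proof. by move=> gt [C ES I M]; split=> //; apply: ctx_upd. Qed.

Lemma auction_cmdP s : ctx (arrs s) (regs s) -> (forall j, j < L -> arrs s 3 j = 0) ->
  let s' := hsem auction_cmd s in
  [/\ ctx (arrs s') (regs s'), row_labels s' = row_labels s,
      auction_inv (labels ent be) L (adj (row_labels s)) (arrs s' 3) (owners s') &
      matchable (row_labels s) ->
      {in labels ent be, forall u, assigned L (arrs s' 3) (owners s') u}].
Proof.
move=> C pr0 s'; set S := row_labels s.
have good0 : auction_good S (0 * N) s.
  by split=> //; [split=> [j ltj|i j lti ltj|j ltj]; rewrite pr0 | right].
have : auction_good S (regs s 2 * N) s'.
  apply: (@hsem_for _ _ _ (fun i s => auction_good S (i * N) s)) => // i s1 _ G.
  have [C1 _ _ _] := auction_good_set i (isT : 11 < 16) G.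
  have := @hsem_for 17 bid_cmd (set_reg s1 16 i) (fun j s => auction_good S (i * N + j) s).
  rewrite (ctx2 C1) mulSnr; apply; first by rewrite addn0; apply: auction_good_set.
  by move=> j s2 _ G2; rewrite addnS; apply: auction_good_bid; apply: auction_good_set.
rewrite (ctx2 C) => -[C' ES I M]; split=> // /M[//|big].
(* Were some label unassigned, [N * N] rounds would have driven the prices to a total of at least (K
   L)^2, while the total never exceeds L (L + 1). *)
have := auction_sum_le I.
have : 3 <= K by rewrite EK (leq_trans p3) // size_labels_ge // ent_uniq.
have NE : N = K * L by rewrite /N /K /L; case: ifP => // _; rewrite mulnC.
by move: big; rewrite NE; nia.
Qed.

Lemma holds_valid ar rg : ctx ar rg ->
  holds ar rg hvalid <-> labelling ent al K (fun i => (ar 1 i, ar 2 i)).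
Proof.
move=> C; pose S i := (ar 1 i, ar 2 i).
have -> : holds ar rg hvalid = all (fun i => (S i \in labels ent al) &&
    all (fun i' => (S i == S i') ==> (i == i')) (iota 0 K)) (iota 0 K).
  rewrite holds_all (ctx2 C) -(all_guard _ leKN); apply: eq_all => i.
  have Ci := @ctx_upd _ _ 31 i isT C.
  rewrite holds_imp holds_lt !heval_reg (ctx8 Ci) upd_id; congr (_ ==> _).
  rewrite 3!holds_and mem_labels /= !holds_sum (ctx2 Ci) -!andbA.
  rewrite -!has_pred1 -!has_cells.
  rewrite (holds_label _ _ (w := al)); last by rewrite -(ctx10 Ci).
  congr [&& _, _, _ & _].
  - by apply: eq_has => n; rewrite holds_eq !heval_rd !heval_reg upd_id (ctx_ar C).
  - by apply: eq_has => n; rewrite holds_eq !heval_rd !heval_reg upd_id (ctx_ar C).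
  rewrite holds_all (ctx2 Ci) -(all_guard _ leKN); apply: eq_all => i'.
  have Ci' := @ctx_upd _ _ 33 i' isT Ci.
  rewrite holds_imp holds_eq holds_and holds_lt holds_and !holds_eq !heval_rd !heval_reg.
  rewrite (ctx8 Ci') upd_id /= xpair_eqE.
  by case: (_ < _) => /=.
have inK i : i < K -> i \in iota 0 K by rewrite mem_iota.
split=> [/allP h|lS].
  apply: labelling_of_inj => // [i lti|i j lti ltj E].
    by have /andP[] := h i (inK i lti).
  have /andP[_ /allP hj] := h i (inK i lti).
  by apply/eqP/(implyP (hj j (inK j ltj)))/eqP.
apply/allP => i; rewrite mem_iota /= => lti; rewrite (labelling_mem lS lti) /=.
apply/allP => j; rewrite mem_iota /= => ltj; apply/implyP => /eqP E; apply/eqP.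
exact: labelling_inj lS lti ltj E.
Qed.

Lemma holds_done ar rg : ctx ar rg ->
  holds ar rg hdone <->
  {in labels ent be, forall u, assigned L (ar 3) (fun j => (ar 4 j, ar 5 j)) u}.
Proof.
move=> C; rewrite holds_all (ctx2 C).
have E n m : n < N -> m < N -> holds ar (upd (upd rg 29 n) 30 m) (hnot (hbidder (HR 29) (HR 30)))
    = ~~ bidder (ar 3) (fun j => (ar 4 j, ar 5 j)) n m.
  move=> ltn ltm; have Cm := @ctx_upd _ _ 30 m isT (@ctx_upd _ _ 29 n isT C).
  have r29 : upd (upd rg 29 n) 30 m 29 = n by [].
  by rewrite holds_not holds_bidder // !heval_reg ?r29 ?upd_id.
split=> [/allP h [b c] uL|h].
  move: (uL); rewrite mem_labels /= => /and3P[bE cE _].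
  have [n ltn An] := A_onto bE; have [m ltm Am] := A_onto cE.
  have := h n; rewrite mem_iota /= holds_all => /(_ ltn)/allP/(_ m).
  have C1 := @ctx_upd _ _ 29 n isT C.
  by rewrite (ctx2 C1) mem_iota /= E // /bidder An Am uL /= negbK; apply.
apply/allP => n; rewrite mem_iota /= => ltn; rewrite holds_all.
have C1 := @ctx_upd _ _ 29 n isT C.
apply/allP => m; rewrite (ctx2 C1) mem_iota /= => ltm; rewrite E // /bidder.
by apply/negP => /andP[uL]; rewrite h.
Qed.

Record base (s : state) : Prop := Base {
  base_ar : arrs s 0 =1 nth 0 (row_major g);
  base0 : regs s 0 = k; base1 : regs s 1 = l; base2 : regs s 2 = N;
  base4 : regs s 4 = size ent;
  base5 : regs s 5 = tr; base6 : regs s 6 = th; base7 : regs s 7 = j0 }.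

(** Soundness holds for every guess: the tested row labels and the owners form the labelling. For
    completeness, a good guess reproduces the row labels [x], and [y] then provides a perfect
    matching, so the auction ends with all labels assigned. *)
Lemma guess_cmdP s : base s ->
  [/\ regs (hsem guess_cmd s) 3 = 1 /\ dav ent al be K L H \/
      regs (hsem guess_cmd s) 3 = regs s 3 &
   forall x y, dav_with ent al be K L H x y ->
     (forall i u, i < K -> row_guess ent th j0 L H i u -> u = x i) ->
     regs (hsem guess_cmd s) 3 = 1].
Proof.
move=> B.
have [s1 [C1 r3 E1]] : exists s1, [/\ ctx (arrs s1) (regs s1), regs s1 3 = regs s 3 &
    hsem guess_cmd s = hsem (HSeq rows_cmd (HSeq (HFor 12 (HWr 3 (HR 12) (HC 0)))
       (HSeq auction_cmd (HCond (hand hvalid hdone) (HAsg 3 (HC 1)) HSkip)))) s1].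
  exists (hsem (HSeq (HAsg 8 (HIf (HR 5) (HR 1) (HR 0))) (HSeq (HAsg 9 (HIf (HR 5) (HR 0) (HR 1)))
   (HSeq (HAsg 10 (hnot (heq (HR 8) (HR 4)))) (HAsg 11 (hnot (heq (HR 9) (HR 4))))))) s).
  split; [|by rewrite hsem_regs|by []].
  split; first by rewrite hsem_arrs //; case: B.
  1-5: by rewrite hsem_regs //; case: B.
  - rewrite 3!hsem_seq hsem_regs // hsem_regs // hsem_regs //= upd_id.
    by rewrite (base5 B) (base1 B) (base0 B).
  - rewrite 3!hsem_seq hsem_regs // hsem_regs //= /upd /=.
    by rewrite (base5 B) (base1 B) (base0 B).
  - rewrite 3!hsem_seq hsem_regs // [regs _ 10]upd_id -/(holds _ _ _) holds_not holds_eq.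
    rewrite !heval_reg hsem_regs // 2?(@hsem_regs _ _ 4) // (base4 B).
    rewrite -(weight_neq2 ent_uniq p3 al2 EK).
    by rewrite /= upd_id (base5 B) (base1 B) (base0 B).
  rewrite 3!hsem_seq [regs _ 11]upd_id -/(holds _ _ _) holds_not holds_eq.
  rewrite !heval_reg hsem_regs // 3?(@hsem_regs _ _ 4) //.
  by rewrite (base4 B) -(weight_neq2 ent_uniq p3 be2 EL) /= /upd /= (base5 B) (base1 B) (base0 B).
rewrite E1 hsem_seq; set s2 := hsem rows_cmd s1.
have C2 : ctx (arrs s2) (regs s2) by apply: ctx_hsem => // x; do 12?[case: x => [|x] //].
have rows := rows_cmdP C1; rewrite -/s2 in rows.
rewrite hsem_seq; set s3 := hsem _ s2.
have C3 : ctx (arrs s3) (regs s3) by apply: ctx_hsem => // x; do 12?[case: x => [|x] //].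
have ES3 : row_labels s3 = row_labels s2.
  by rewrite /row_labels /s3 (@hsem_arrs _ s2 1) // (@hsem_arrs _ s2 2).
have pr0 j : j < L -> arrs s3 3 j = 0.
  move=> ltj; suff : forall j, j < regs s2 2 -> arrs s3 3 j = 0.
    by rewrite (ctx2 C2); apply; apply: leq_trans leLN.
  apply: (@hsem_for _ _ _ (fun i s => forall j, j < i -> arrs s 3 j = 0)) => // i s' _ IH m ltm.
  by rewrite /= /upd /=; case: eqP => // nmi; apply: IH; lia.
have [] := auction_cmdP C3 pr0.
rewrite hsem_seq; set s4 := hsem auction_cmd s3; rewrite ES3 => C4 ES4 I4 M4.
have r43 : regs s4 3 = regs s 3.
  by rewrite /s4 hsem_regs // /s3 hsem_regs // /s2 hsem_regs.
set S := row_labels s2 in rows ES3 ES4 I4 M4.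
have V : holds (arrs s4) (regs s4) hvalid <-> labelling ent al K S.
  by rewrite -ES4; apply: holds_valid.
have Dn := holds_done C4.
rewrite hsem_cond holds_and; split.
  case: ifP => [/andP[/V lS /Dn done]|_]; last by right.
  left; split; first by rewrite /= upd_id.
  have [lY adjY] := auction_all_assigned (labels_uniq be ent_uniq) (esym EL) I4 done.
  exists S, (owners s4); split=> // i j lti ltj.
  have /andP[_ /allP/(_ i)] := adjY j ltj.
  by rewrite mem_iota /= lti; apply; apply: leq_trans leKN.
move=> x y [lx ly ok] good.
have SE i : i < K -> S i = x i.
  by move=> lti; apply: good => //; apply: rows; apply: leq_trans leKN.
have lS : labelling ent al K S.
  rewrite /labelling (_ : map S (iota 0 K) = map x (iota 0 K)) //.
  by apply/eq_in_map => i; rewrite mem_iota; apply: SE.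
have mS : matchable S.
  (* The matching sends a label to the column that carries it under [y]. *)
  pose m u := index u (map y (iota 0 L)).
  have ym u : u \in labels ent be -> m u < L /\ y (m u) = u.
    rewrite -(perm_mem ly) => uy.
    have lt : m u < L by rewrite -[X in _ < X](size_iota 0 L) -(size_map y) index_mem.
    split=> //; have := nth_index (0, 0) uy.
    by rewrite -/(m u) (nth_map 0) ?size_iota // nth_iota.
  exists m; last by move=> u v /ym[_ yu] /ym[_ yv] E; rewrite -yu E yv.
  move=> u /ym[lt yu]; rewrite /adj lt /=; apply/allP => i _; apply/implyP => lti.
  by rewrite SE // -{1}yu; apply: ok.
by rewrite (V.2 lS) (Dn.2 (M4 mS)) /= upd_id.
Qed.

End Guess.

(** * Search over all guesses *)

(** [F] is a flag that no round lowers, so a single round [i] satisfying [G] raises it for good; the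
    three nested guessing loops are three instances. *)
Lemma for_search (n : nat) (x : nat) (c : hcmd) (I F : state -> Prop) (G : nat -> Prop) :
  (forall s, I s -> regs s 2 = n) ->
  (forall i s, i < n -> I s ->
     [/\ I (hsem c (set_reg s x i)), F s -> F (hsem c (set_reg s x i)) &
         G i -> F (hsem c (set_reg s x i))]) ->
  forall s, I s ->
  [/\ I (hsem (HFor x c) s), F s -> F (hsem (HFor x c) s) &
      (exists2 i, i < n & G i) -> F (hsem (HFor x c) s)].
Proof.
move=> In step s Is.
have : [/\ I (hsem (HFor x c) s), F s -> F (hsem (HFor x c) s) &
    forall i, i < regs s 2 -> G i -> F (hsem (HFor x c) s)].
  apply: (@hsem_for x c s (fun m s' => [/\ I s', F s -> F s' &
    forall i, i < m -> G i -> F s'])) => // i s'; rewrite (In s Is) => lti [I' F' G'].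
  have [I1 F1 G1] := step i s' lti I'; split=> // [/F'|j]; first exact: F1.
  by rewrite ltnS leq_eqVlt => /orP[/eqP->|/G' + /[dup] ?]; [exact: G1 | move=> h /h /F1].
by rewrite (In s Is) => -[h1 h2 h3]; split=> // -[i lti]; apply: h3.
Qed.

(** [undup] keeps the last occurrence of each value, that is, the positions whose value does not
    recur later. *)
Lemma size_undup_sum (s : seq nat) : size (undup s) =
  \sum_(0 <= n < size s)
     all (fun m => (n < m) ==> (nth 0 s m != nth 0 s n)) (iota 0 (size s)).
Proof.
elim: s => [|x s IH]; first by rewrite big_nil.
rewrite big_nat_recl //= [iota 1 _](iotaDl 1 0) all_map /=.
have -> : \sum_(0 <= i < size s)
    all (fun m => (i.+1 < m) ==> (nth 0 (x :: s) m != nth 0 s i)) [seq 1 + j | j <- iota 0 (size s)]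
    = size (undup s).
  by rewrite IH; apply: eq_bigr => i _; rewrite all_map.
have -> : all (preim (addn 1) (fun m => (0 < m) ==> (nth 0 (x :: s) m != x))) (iota 0 (size s))
    = (x \notin s).
  rewrite -has_pred1 -all_predC -[in RHS](mkseq_nth 0 s) all_map.
  by apply: eq_all => i /=.
by case: (x \in s).
Qed.

(** Written directly as a machine program, since the loop language needs its bound k l in register 2
    beforehand. The counter in register 3 ends at 0, as the answer flag must start. *)
Definition product_cmd :=
  Seq (Assign 3 (Reg 0))
    (While (Reg 3) (Seq (Assign 2 (Add (Reg 2) (Reg 1)))
                        (Assign 3 (Defs.Sub (Reg 3) (Const 1))))).

Lemma product_cmdP s : regs s 2 = 0 -> regs s 3 = 0 ->
  exists2 s', runs product_cmd s (10 * regs s 0 + 4) s' &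
    [/\ arrs s' = arrs s, regs s' 2 = regs s 0 * regs s 1 &
        forall x, x != 2 -> regs s' x = regs s x].
Proof.
move=> s2 s3; set k := regs s 0.
pose P i s' := [/\ regs s' 3 = k - i, arrs s' = arrs s, regs s' 2 = i * regs s 1 &
  forall x, x != 2 -> x != 3 -> regs s' x = regs s x].
have [|||s' r [r3 ra r2 rx]] := @runs_while P (Reg 3) (Seq (Assign 2 (Add (Reg 2) (Reg 1)))
  (Assign 3 (Defs.Sub (Reg 3) (Const 1)))) 8 k (set_reg s 3 k).
- by move=> i s' [].
- move=> i s' lti [r3 ra r2 rx].
  eexists.
    apply: (runs_seq (T1 := 4) (T2 := 4)); first exact: (runs_assign s' 2 (Add (Reg 2) (Reg 1))).
    exact: (runs_assign _ 3 (Defs.Sub (Reg 3) (Const 1))).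
  split=> //=; rewrite /upd /= ?r3 ?r2 ?rx //; try by lia.
  by move=> x n2 n3; rewrite (negbTE n2) (negbTE n3) rx.
- split=> //=; rewrite /upd /= ?subn0 // => x _ /negbTE->.
  by [].
exists s'; last first.
  split=> // x n2; case: (eqVneq x 3) => [->|n3]; last exact: rx.
  by rewrite r3 subnn s3.
apply: (@runs_le _ _ (2 + (10 * k + 2))); first by lia.
exact: runs_seq (runs_assign s 3 (Reg 0)) r.
Qed.

Section Main.
Variables (k l : nat) (g : 'M[nat]_(k, l)) (alpha beta : nat).
Let N := k * l.
Let ent := entries g.
Hypotheses (k0 : 0 < k) (l0 : 0 < l).
Hypotheses (al2 : 0 < alpha <= 2) (be2 : 0 < beta <= 2) (p3 : 3 <= size ent).
Hypotheses (Ek : k = size (labels ent alpha)) (El : l = size (labels ent beta)).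

Let DAV := dav ent alpha beta k l (cell g).

Let row_weight tr := if tr != 0 then beta else alpha.
Let col_weight tr := if tr != 0 then alpha else beta.
Let nrows tr := if tr != 0 then l else k.
Let ncols tr := if tr != 0 then k else l.
Let oriented tr i j := if tr != 0 then cell g j i else cell g i j.

Let good_guess tr th j0 : Prop := exists x y,
  dav_with ent (row_weight tr) (col_weight tr) (nrows tr) (ncols tr) (oriented tr) x y /\
  forall i u, i < nrows tr -> row_guess ent th j0 (ncols tr) (oriented tr) i u -> u = x i.

Lemma good_guess_exists : DAV ->
  exists2 tr, tr < N & exists2 th, th < N & exists2 j0, j0 < N & good_guess tr th j0.
Proof.
move=> [x [y D]]; have HE i j : i < k -> j < l -> cell g i j \in ent by apply: cell_entries.
(* The orientation is a loop counter as well, so the value 1 has to be below [N]. *)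
have N9 : 1 < N.
  have kp : size ent <= k by rewrite Ek size_labels_ge // undup_uniq.
  rewrite /N; nia.
have [[th [j0 [lth lj h]]]|[th [j0 [lth lj h]]]] :=
  dav_guess (undup_uniq _) p3 al2 be2 Ek El HE D.
  exists 0; first exact: ltnW.
  by exists th => //; exists j0 => //; exists x, y.
exists 1 => //; exists th => //; exists j0 => //; exists y, x; split=> //.
exact: dav_with_tr.
Qed.

(** The last clause carries soundness through the loops. *)
Let invariant (s : state) : Prop :=
  [/\ arrs s 0 =1 nth 0 (row_major g), regs s 0 = k /\ regs s 1 = l, regs s 2 = N,
      regs s 4 = size ent & regs s 3 = 0 \/ regs s 3 = 1 /\ DAV].

Let accepted (s : state) : Prop := regs s 3 = 1.

Lemma invariant_set s x v : 4 < x -> invariant s -> invariant (set_reg s x v).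
Proof. by move=> gt [? [? ?] ? ? ?]; split; rewrite /= ?upd_neq //; lia. Qed.

Lemma guess_step tr th j0 s : j0 < N -> invariant s ->
  regs s 5 = tr -> regs s 6 = th -> regs s 7 = j0 ->
  [/\ invariant (hsem guess_cmd s), accepted s -> accepted (hsem guess_cmd s) &
      good_guess tr th j0 -> accepted (hsem guess_cmd s)].
Proof.
move=> ltj [ha [h0 h1] h2 h4 h3] s5 s6 s7.
have B : base g tr th j0 s by split.
have rw2 : 0 < row_weight tr <= 2 by rewrite /row_weight; case: ifP.
have cw2 : 0 < col_weight tr <= 2 by rewrite /col_weight; case: ifP.
have EK : nrows tr = size (labels ent (row_weight tr)).
  by rewrite /nrows /row_weight; case: ifP.
have EL : ncols tr = size (labels ent (col_weight tr)).
  by rewrite /ncols /col_weight; case: ifP.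
have [ans acc] := guess_cmdP k0 l0 rw2 cw2 EK EL ltj p3 B.
have toDAV : dav ent (row_weight tr) (col_weight tr) (nrows tr) (ncols tr) (oriented tr) -> DAV.
  rewrite /row_weight /col_weight /nrows /ncols /oriented; case: ifP => // _ [x [y D]].
  by exists y, x; apply: dav_with_tr D.
split; first split.
- by rewrite hsem_arrs.
- by rewrite !hsem_regs.
- by rewrite hsem_regs.
- by rewrite hsem_regs.
- by case: ans => [[-> /toDAV]|->]; [right | ].
- by rewrite /accepted; case: ans => [[]|->].
- by move=> [x [y [D good]]]; apply: acc D good.
Qed.

Lemma main_cmdP s : arrs s 0 =1 nth 0 (row_major g) ->
  regs s 0 = k -> regs s 1 = l -> regs s 2 = N -> regs s 3 = 0 ->
  answers (hsem main_cmd s) DAV.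
Proof.
move=> ha h0 h1 h2 h3.
set e := HSum 20 (hall 21 (himp (hlt (HR 20) (HR 21))
  (hnot (heq (HRd 0 (HR 21)) (HRd 0 (HR 20)))))).
have Ev : heval (arrs s) (regs s) e = size ent.
  rewrite /ent /entries size_undup_sum size_row_major heval_sum h2.
  apply: eq_bigr => n _; rewrite heval_not -holds_not -/(hall _ _) holds_all.
  congr nat_of_bool; rewrite upd_neq // h2; apply: eq_all => m.
  rewrite holds_imp holds_lt holds_not holds_eq !heval_rd !heval_reg upd_id.
  by rewrite upd_neq // upd_id !ha.
rewrite /main_cmd hsem_seq (hsem_asg _ Ev) hsem_seq.
set s1 := set_reg s 4 _.
have I1 : invariant s1.
  by split=> //; left.
have In s' : invariant s' -> regs s' 2 = N by case.
have [|I2 _ F2] := @for_search N 5 (HFor 6 (HFor 7 guess_cmd)) invariant accepted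
  (fun tr => exists2 th, th < N & exists2 j0, j0 < N & good_guess tr th j0) In _ s1 I1.
  move=> tr sa lttr Ia.
  have Ia' : invariant (set_reg sa 5 tr) /\ regs (set_reg sa 5 tr) 5 = tr.
    by split; [apply: invariant_set | rewrite /= upd_id].
  have [| |Ib Fb Gb] := @for_search N 6 (HFor 7 guess_cmd)
    (fun s => invariant s /\ regs s 5 = tr) accepted
    (fun th => exists2 j0, j0 < N & good_guess tr th j0) _ _ _ Ia'.
  - by move=> s' [/In].
  - move=> th sb ltth [Ib b5].
    have Ib' : [/\ invariant (set_reg sb 6 th), regs (set_reg sb 6 th) 5 = tr &
        regs (set_reg sb 6 th) 6 = th].
      by split; rewrite /= ?upd_id ?upd_neq //; apply: invariant_set.
    have [| |[Ic c5 c6] Fc Gc] := @for_search N 7 guess_cmd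
      (fun s => [/\ invariant s, regs s 5 = tr & regs s 6 = th]) accepted
      (good_guess tr th) _ _ _ Ib'.
    + by move=> s' [/In].
    + move=> j0 sc ltj [Ic c5 c6].
      have [||||Id Fd Gd] := @guess_step tr th j0 (set_reg sc 7 j0) ltj.
      * exact: invariant_set.
      * by [].
      * by [].
      * by [].
      by split=> //; split; rewrite ?hsem_regs.
    by split.
  by split=> //; case: Ib.
case: I2; set s2 := hsem _ s1 in F2 *; move=> _ _ _ _ [r3|[r3 D]].
  right; split; first by rewrite /= upd_id.
  by move/good_guess_exists/F2; rewrite /accepted r3.
by left; split; first by rewrite /= upd_id.
Qed.

End Main.

Theorem mainTheorem6 :
  exists (prog : cmd) (q : {poly nat}),
    forall (k l : nat) (g : 'M[nat]_(k, l)) (alpha beta : nat),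
      voting_form g alpha beta ->
      3 <= ncand g -> alpha <= 2 -> beta <= 2 ->
      exists (t : nat) (s : state),
        [/\ exec prog (input g) t s,
            t <= (q.[(k * l)%N])%R &
            answers s (DAV_form g alpha beta)].
Proof.
have [q Eq] : polynomial_fun (fun n => 10 * n + 4 + ctime main_cmd n).
  apply: polynomial_fun_add (ctime_poly _); apply: polynomial_fun_add (polynomial_fun_const _).
  exact: polynomial_fun_mul (polynomial_fun_const _) polynomial_fun_id.
(* The registers of the source end at 33, so temporaries from 40 on cannot clash with them. *)
exists (Seq product_cmd (ccompile 40 main_cmd)), q => k l g alpha beta.
rewrite /voting_form ncandE => -[al0 be0 Ek El] p3 al2 be2.
have uE : uniq (entries g) by apply: undup_uniq.
have p0 : 0 < size (entries g) by apply: leq_trans p3.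
have {}al2 : 0 < alpha <= 2 by rewrite al0.
have {}be2 : 0 < beta <= 2 by rewrite be0.
have Ek' : k = size (labels (entries g) alpha) by rewrite size_labels.
have El' : l = size (labels (entries g) beta) by rewrite size_labels.
have k0 : 0 < k by rewrite Ek'; apply: leq_trans p0 (size_labels_ge uE _).
have l0 : 0 < l by rewrite El'; apply: leq_trans p0 (size_labels_ge uE _).
have [//|//|s1 r1 [a1 n1 x1]] := @product_cmdP (input g).
have [||||s2 r2 [k2 _]] := @ccompileP 40 main_cmd 40 s1 s1 => //.
have ans := @main_cmdP k l g alpha beta k0 l0 al2 be2 p3 Ek' El' s1.
have [t ex let_] := runs_seq r1 r2.
exists t, s2; split=> //.
  (* Computing the product takes time linear in k, and k <= k l because l is positive. *)
  rewrite -Eq; apply: leq_trans let_ _; rewrite n1 /= leq_add2r leq_add2r leq_mul2l /=.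
  by rewrite leq_pmulr.
have := ans _ (x1 0 isT) (x1 1 isT) n1 (x1 3 isT).
rewrite /answers k2.2 // (DAV_formE al2 be2 Ek' El') a1; apply.
by [].
Qed.
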